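(* For every formula $\varphi$ and every set of formulas $\Gamma$ in the propositional language with connectives $\wedge,\vee,\to,\sim,\square,\lozenge,0,1$, $$\Gamma \vdash_{\mathcal{S}5(\mathcal{G}_\sim)} \varphi \iff \Gamma \models_{\mathcal{S}5(\mathbb{G}_\sim)} \varphi \iff \Gamma \models_{\mathbb{CMG}_\sim}\varphi .$$
   Context: A Gödel algebra is a Heyting algebra $\langle A,\vee,\wedge,\to,0,1\rangle$ satisfying $(x\to y)\vee(y\to x)\approx 1$; put $\neg x:=x\to 0$. A De Morgan algebra is a bounded distributive lattice with a unary operation $\sim$ satisfying $\sim\sim x\approx x$ and $\sim(x\wedge y)\approx \sim x\vee\sim y$. A $G_\sim$-algebra $\langle \mathbf A,\sim\rangle$ is a Gödel algebra $\mathbf A$ with a unary operation $\sim$ that makes its bounded lattice reduct a De Morgan algebra and satisfies $\neg x\le\sim x$. An $MG_\sim$-algebra is an algebra $\langle A,\vee,\wedge,\to,\sim,\exists,\forall,0,1\rangle$ such that $\langle \mathbf A,\sim\rangle$ is a $G_\sim$-algebra and: (M1) $\forall x\to x\approx 1$; (M2) $\forall(x\to\forall y)\approx\exists x\to\forall y$; (M3) $\forall(\forall x\to y)\approx\forall x\to\forall y$; (M4) $\forall(\exists x\vee y)\approx\exists x\vee\forall y$; (Q) $\forall x\approx\ \sim\exists\sim x$. The variety $\mathbb{CMG}_\sim$ is the class of $MG_\sim$-algebras satisfying (C): $\exists(x\wedge\sim x)\le\forall(x\vee\sim x)$. Relation $\models_{\mathbb{CMG}_\sim}$: $\Gamma\models_{\mathbb{CMG}_\sim}\varphi$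 means that for every $\mathbf A\in\mathbb{CMG}_\sim$ and every homomorphism $h$ from the formula algebra to $\mathbf A$ (with $\square,\lozenge$ interpreted by $\forall,\exists$), if $h(\gamma)=1$ for all $\gamma\in\Gamma$ then $h(\varphi)=1$. Relation $\models_{\mathcal{S}5(\mathbb{G}_\sim)}$: a structure is a triple $\mathbf K=\langle W,e,\mathbf L\rangle$ with $W$ a nonempty set, $\mathbf L$ a totally ordered $G_\sim$-algebra, and $e:W\times Prop\to L$, where $Prop$ is the set of propositional variables. Truth degrees: $\|p\|_{\mathbf K,w}=e(w,p)$ for $p\in Prop$; $0,1,\wedge,\vee,\to,\sim$ are interpreted at $w$ by the operations of $\mathbf L$; $\|\square\varphi\|_{\mathbf K,w}=\inf\{\|\varphi\|_{\mathbf K,v}:v\in W\}$; $\|\lozenge\varphi\|_{\mathbf K,w}=\sup\{\|\varphi\|_{\mathbf K,v}:v\in W\}$. $\mathbf K$ is safe if all these infima and suprema exist in $\mathbf L$ for all formulas. A model of $\Gamma$ is a safe structure with $\|\gamma\|_{\mathbf K,w}=1$ for all $\gamma\in\Gamma$, $w\in W$. $\Gamma\models_{\mathcal{S}5(\mathbb{G}_\sim)}\varphi$ means that $\|\varphi\|_{\mathbf K,w}=1$ for every model $\mathbf K=\langle W,e,\mathbf L\rangle$ of $\Gamma$ and every $w\in W$. Relation $\vdash_{\mathcal{S}5(\mathcal{G}_\sim)}$: derivability (from hypotheses, all rules applicable to hypotheses) in the following Hilbert calculus, where $\neg\varphi:=\varphi\to 0$, $\Delta\varphi:=\neg\sim\varphi$,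 $\varphi\equiv\psi:=(\varphi\to\psi)\wedge(\psi\to\varphi)$. Axiom schemata: (Gödel logic) $\varphi\to(\psi\to\varphi)$; $(\varphi\to(\psi\to\chi))\to((\varphi\to\psi)\to(\varphi\to\chi))$; $\varphi\wedge\psi\to\varphi$; $\varphi\wedge\psi\to\psi$; $\varphi\to(\psi\to\varphi\wedge\psi)$; $\varphi\to\varphi\vee\psi$; $\psi\to\varphi\vee\psi$; $(\varphi\to\chi)\to((\psi\to\chi)\to(\varphi\vee\psi\to\chi))$; $0\to\varphi$; $\varphi\to 1$; $(\varphi\to\psi)\vee(\psi\to\varphi)$; (modal) $\square\varphi\to\varphi$; $\square(\varphi\to\square\psi)\equiv(\lozenge\varphi\to\square\psi)$; $\square(\square\varphi\to\psi)\equiv(\square\varphi\to\square\psi)$; $\square(\lozenge\varphi\vee\psi)\equiv(\lozenge\varphi\vee\square\psi)$; (negation) $\sim\sim\varphi\equiv\varphi$; $\neg\varphi\to\sim\varphi$; $\Delta(\varphi\to\psi)\to\Delta(\sim\psi\to\sim\varphi)$; $\Delta\varphi\vee\neg\Delta\varphi$; $\Delta(\varphi\vee\psi)\to(\Delta\varphi\vee\Delta\psi)$; $\Delta(\varphi\to\psi)\to(\Delta\varphi\to\Delta\psi)$; $\square\varphi\equiv\ \sim\lozenge\sim\varphi$; $\lozenge(\varphi\wedge\sim\varphi)\to\square(\varphi\vee\sim\varphi)$. Rules: modus ponens, $\varphi/\square\varphi$, and $\varphi/\Delta\varphi$. *)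

(* Defs.v *)
From HB Require Import structures.
From mathcomp Require Import all_boot all_order.
From mathcomp Require Import boolp classical_sets.

Set Implicit Arguments.
Unset Strict Implicit.
Unset Printing Implicit Defensive.

Import Order.TTheory.
Local Open Scope classical_set_scope.
Local Open Scope order_scope.

(* In all the classes below 0 and 1 are [\bot] and [\top], and [\bot = \top] is
   allowed.  Classically every type has the decidable equality and the choice
   operator that the underlying order structures require, so that these classes
   contain all the algebras in question. *)

HB.mixin Record hasHeytingImp d T of Order.TBDistrLattice d T := {
  himp : T -> T -> T;
  himpP : forall x y z : T, (x `&` y <= z) = (x <= himp y z)
}.
#[short(type="heytingType")]
HB.structure Definition Heyting d :=
  { T of Order.TBDistrLattice d T & hasHeytingImp d T }.

HB.mixin Record Heyting_isGodel d T of Heyting d T := {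
  himp_prelinear : forall x y : T, himp x y `|` himp y x = \top
}.
#[short(type="godelType")]
HB.structure Definition Godel d := { T of Heyting d T & Heyting_isGodel d T }.

Definition hneg d (T : heytingType d) (x : T) : T := himp x \bot.

HB.mixin Record hasDeMorganNeg d T of Order.TBDistrLattice d T := {
  dmneg : T -> T;
  dmnegK : forall x : T, dmneg (dmneg x) = x;
  dmnegI : forall x y : T, dmneg (x `&` y) = dmneg x `|` dmneg y
}.
#[short(type="deMorganType")]
HB.structure Definition DeMorgan d :=
  { T of Order.TBDistrLattice d T & hasDeMorganNeg d T }.

HB.mixin Record isGSim d T of Godel d T & DeMorgan d T := {
  hneg_le_dmneg : forall x : T, hneg x <= dmneg x
}.
#[short(type="gSimType")]
HB.structure Definition GSim d :=
  { T of Godel d T & DeMorgan d T & isGSim d T }.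

HB.mixin Record hasMonadicQuantifiers d T of GSim d T := {
  mexists : T -> T;
  mforall : T -> T;
  monM1 : forall x : T, himp (mforall x) x = \top;
  monM2 : forall x y : T,
    mforall (himp x (mforall y)) = himp (mexists x) (mforall y);
  monM3 : forall x y : T,
    mforall (himp (mforall x) y) = himp (mforall x) (mforall y);
  monM4 : forall x y : T,
    mforall (mexists x `|` y) = mexists x `|` mforall y;
  monQ : forall x : T, mforall x = dmneg (mexists (dmneg x))
}.
#[short(type="mgSimType")]
HB.structure Definition MGSim d :=
  { T of GSim d T & hasMonadicQuantifiers d T }.

HB.mixin Record isCMGSim d T of MGSim d T := {
  monC : forall x : T, mexists (x `&` dmneg x) <= mforall (x `|` dmneg x)
}.
#[short(type="cmgSimType")]
HB.structure Definition CMGSim d := { T of MGSim d T & isCMGSim d T }.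

(* Nothing is assumed on the set [V] of propositional variables. *)
Inductive formula (V : Type) : Type :=
| Var (p : V)
| Bot
| Top
| And (a b : formula V)
| Or (a b : formula V)
| Imp (a b : formula V)
| Sim (a : formula V)
| Box (a : formula V)
| Dia (a : formula V).

Arguments Bot {V}.
Arguments Top {V}.

Declare Scope modal_scope.
Delimit Scope modal_scope with M.
Bind Scope modal_scope with formula.

Infix "∧" := And (at level 48, left associativity) : modal_scope.
Infix "∨" := Or (at level 50, left associativity) : modal_scope.
Infix "⟶" := Imp (at level 55, right associativity) : modal_scope.
Notation "∼ a" := (Sim a) (at level 35, right associativity) : modal_scope.
Notation "□ a" := (Box a) (at level 35, right associativity) : modal_scope.
Notation "◇ a" := (Dia a) (at level 35, right associativity) : modal_scope.

Definition Neg V (a : formula V) : formula V := Imp a Bot.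
Definition Delta V (a : formula V) : formula V := Neg (Sim a).
Definition Equ V (a b : formula V) : formula V := And (Imp a b) (Imp b a).

Notation "¬ a" := (Neg a) (at level 35, right associativity) : modal_scope.
Notation "'Δ' a" := (Delta a) (at level 35, right associativity) : modal_scope.
Notation "a ≡ b" := (Equ a b) (at level 60, no associativity) : modal_scope.

Inductive S5axiom (V : Type) : formula V -> Prop :=
| ax_K a b : S5axiom (a ⟶ b ⟶ a)
| ax_S a b c : S5axiom ((a ⟶ b ⟶ c) ⟶ (a ⟶ b) ⟶ a ⟶ c)
| ax_andl a b : S5axiom (a ∧ b ⟶ a)
| ax_andr a b : S5axiom (a ∧ b ⟶ b)
| ax_and a b : S5axiom (a ⟶ b ⟶ a ∧ b)
| ax_orl a b : S5axiom (a ⟶ a ∨ b)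
| ax_orr a b : S5axiom (b ⟶ a ∨ b)
| ax_or a b c : S5axiom ((a ⟶ c) ⟶ (b ⟶ c) ⟶ a ∨ b ⟶ c)
| ax_bot a : S5axiom (Bot ⟶ a)
| ax_top a : S5axiom (a ⟶ Top)
| ax_prelinear a b : S5axiom ((a ⟶ b) ∨ (b ⟶ a))
| ax_box a : S5axiom (□ a ⟶ a)
| ax_box_imp_box a b : S5axiom (□ (a ⟶ □ b) ≡ (◇ a ⟶ □ b))
| ax_box_box_imp a b : S5axiom (□ (□ a ⟶ b) ≡ (□ a ⟶ □ b))
| ax_box_dia_or a b : S5axiom (□ (◇ a ∨ b) ≡ (◇ a ∨ □ b))
| ax_simK a : S5axiom (∼ ∼ a ≡ a)
| ax_neg_sim a : S5axiom (¬ a ⟶ ∼ a)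
| ax_Delta_sim a b : S5axiom (Δ (a ⟶ b) ⟶ Δ (∼ b ⟶ ∼ a))
| ax_Delta_em a : S5axiom (Δ a ∨ ¬ Δ a)
| ax_Delta_or a b : S5axiom (Δ (a ∨ b) ⟶ Δ a ∨ Δ b)
| ax_Delta_imp a b : S5axiom (Δ (a ⟶ b) ⟶ Δ a ⟶ Δ b)
| ax_box_sim a : S5axiom (□ a ≡ ∼ ◇ ∼ a)
| ax_dia_box_sim a : S5axiom (◇ (a ∧ ∼ a) ⟶ □ (a ∨ ∼ a)).

Inductive S5derives (V : Type) (Gamma : set (formula V)) : formula V -> Prop :=
| der_hyp a : Gamma a -> S5derives Gamma a
| der_axiom a : S5axiom a -> S5derives Gamma a
| der_mp a b : S5derives Gamma (a ⟶ b) -> S5derives Gamma a ->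
    S5derives Gamma b
| der_nec a : S5derives Gamma a -> S5derives Gamma (□ a)
| der_Delta a : S5derives Gamma a -> S5derives Gamma (Δ a).

Record S5structure (V : Type) := {
  world : Type;
  world_inhabited : inhabited world;
  degree_disp : Order.disp_t;
  degree : gSimType degree_disp;
  degree_total : total (<=%O : rel degree);
  assignment : world -> V -> degree
}.

(* [infimum] and [supremum] return the default value [\bot] when the bound does
   not exist, so that [truth] is meaningful for safe structures only. *)
Fixpoint truth (V : Type) (K : S5structure V) (a : formula V) :
    world K -> degree K :=
  match a with
  | Var p => fun w => assignment w p
  | Bot => fun=> \bot
  | Top => fun=> \top
  | And b c => fun w => truth b w `&` truth c w
  | Or b c => fun w => truth b w `|` truth c w
  | Imp b c => fun w => himp (truth b w) (truth c w)
  | Sim b => fun w => dmneg (truth b w)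
  | Box b => fun=> @infimum _ (degree K) \bot (range (truth b))
  | Dia b => fun=> @supremum _ (degree K) \bot (range (truth b))
  end.

Definition safe (V : Type) (K : S5structure V) : Prop :=
  forall a : formula V,
    infimums (range (@truth V K a)) !=set0 /\
    supremums (range (@truth V K a)) !=set0.

Definition S5model (V : Type) (Gamma : set (formula V)) (K : S5structure V) :=
  safe K /\ forall a, Gamma a -> forall w : world K, truth a w = \top.

Definition S5entails (V : Type) (Gamma : set (formula V)) (a : formula V) :=
  forall K : S5structure V, S5model Gamma K ->
  forall w : world K, truth a w = \top.

Record formula_morphism (V : Type) d (A : cmgSimType d)
    (h : formula V -> A) : Prop := {
  hom_bot : h Bot = \bot;
  hom_top : h Top = \top;
  hom_and : forall a b, h (a ∧ b)%M = h a `&` h b;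
  hom_or : forall a b, h (a ∨ b)%M = h a `|` h b;
  hom_imp : forall a b, h (a ⟶ b)%M = himp (h a) (h b);
  hom_sim : forall a, h (∼ a)%M = dmneg (h a);
  hom_box : forall a, h (□ a)%M = mforall (h a);
  hom_dia : forall a, h (◇ a)%M = mexists (h a)
}.

Definition CMGentails (V : Type) (Gamma : set (formula V)) (a : formula V) :=
  forall (d : Order.disp_t) (A : cmgSimType d) (h : formula V -> A),
    formula_morphism h -> (forall g, Gamma g -> h g = \top) -> h a = \top.

(* Main.v *)
(* Completeness for CMG-algebras is witnessed by the Lindenbaum algebra.  To
   refute an equation of a CMG-algebra A in a structure over a chain, let C be
   the subalgebra of fixed points of [mforall], choose an ultrafilter F0 (of
   Delta-filters) that omits the given element, and consider all ultrafilters
   that agree with F0 on C.  Each of them localizes A to a chain, and all these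
   chains contain the chain D obtained from C.  They are amalgamated over D by
   taking, for each of them, copies indexed by the integers and by stacking,
   inside each cut of D, the parts of the copies that fall into that cut.  By
   compactness, if the infimum of x is not attained then x lies, at some
   ultrafilter, in the cut just above it, and the copies of that ultrafilter
   come arbitrarily low in the cut; so infima are preserved, and suprema by
   duality.  Axiom (C) says that the only cut which the involution maps to
   itself is empty, which allows the stacking order to be reversed between the
   two halves of D, so that the involution extends to the amalgam. *)
From HB Require Import structures.
Require Import Defs.
From mathcomp Require Import all_boot all_order ssralg ssrnum ssrint.
From mathcomp Require Import boolp classical_sets wochoice.

Set Implicit Arguments.
Unset Strict Implicit.
Unset Printing Implicit Defensive.

Import Order.TTheory GRing.Theory Num.Theory.
Local Open Scope classical_set_scope.
Local Open Scope order_scope.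

(** * Gödel algebras with an involution *)

Section HeytingTheory.
Context {d : Order.disp_t} {T : heytingType d}.
Implicit Types x y z : T.

Lemma himp_eq1 x y : (himp x y == \top) = (x <= y).
Proof. by rewrite -le1x -himpP meet1x. Qed.

Lemma himp_mp x y : himp x y `&` x <= y.
Proof. by rewrite himpP. Qed.

Lemma le_himp x y z : y <= z -> himp x y <= himp x z.
Proof. by move=> yz; rewrite -himpP (le_trans (himp_mp x y)). Qed.

Lemma le_himpl x y z : x <= y -> himp y z <= himp x z.
Proof.
by move=> xy; rewrite -himpP; apply: le_trans (himp_mp y z); rewrite leI2.
Qed.

Lemma le_himpr x y : y <= himp x y.
Proof. by rewrite -himpP leIl. Qed.

Lemma himp1x x : himp \top x = x.
Proof.
by apply/le_anti; rewrite le_himpr andbT; have := himp_mp \top x; rewrite meetx1.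
Qed.

Lemma himp_comp x y z : himp x y `&` himp y z <= himp x z.
Proof.
rewrite -himpP meetC meetA; apply: le_trans (himp_mp y z).
by rewrite meetC leI2 // meetC himp_mp.
Qed.

Lemma himpI x y z : himp x y `&` himp x z = himp x (y `&` z).
Proof.
apply/le_anti; rewrite lexI !le_himp ?leIl ?leIr // !andbT -himpP lexI.
by rewrite (le_trans _ (himp_mp x y)) ?(le_trans _ (himp_mp x z)) ?leI2 ?leIl ?leIr.
Qed.

Lemma himpUl x y z : himp (x `|` y) z = himp x z `&` himp y z.
Proof.
apply/le_anti; rewrite lexI !le_himpl ?leUl ?leUr //= -himpP meetUr leUx.
by rewrite (le_trans _ (himp_mp x z)) ?(le_trans _ (himp_mp y z)) ?leI2 ?leIl ?leIr.
Qed.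

Lemma le_hneg x y : x <= y -> hneg y <= hneg x.
Proof. exact: le_himpl. Qed.

Lemma hnegP x y : (x `&` y <= \bot) = (x <= hneg y).
Proof. exact: himpP. Qed.

Lemma hnegI0 x : hneg x `&` x = \bot.
Proof. by apply/eqP; rewrite -lex0 hnegP. Qed.

Lemma le_hnegK x : x <= hneg (hneg x).
Proof. by rewrite -hnegP meetC hnegI0. Qed.

Lemma hneg3 x : hneg (hneg (hneg x)) = hneg x.
Proof. by apply/le_anti; rewrite le_hnegK andbT le_hneg ?le_hnegK. Qed.

Lemma hnegU x y : hneg (x `|` y) = hneg x `&` hneg y.
Proof. exact: himpUl. Qed.

End HeytingTheory.

Section GodelTheory.
Context {d : Order.disp_t} {T : godelType d}.
Implicit Types x y z : T.

(** Prelinearity splits the left side in two parts. On the part below [himp x y], the element [x]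
    lies below the meet, so negating the meet refutes [x]; the other part refutes [y]. *)
Lemma hnegI x y : hneg (x `&` y) = hneg x `|` hneg y.
Proof.
apply/le_anti/andP; split; last by rewrite leUx !le_hneg ?leIl ?leIr.
rewrite -[leLHS]meetx1 -(himp_prelinear x y) meetUr leU2 // -hnegP -meetA.
  by apply: le_trans (himp_mp (x `&` y) \bot); rewrite leI2 // lexI himp_mp leIr.
by apply: le_trans (himp_mp (x `&` y) \bot); rewrite leI2 // lexI himp_mp leIr.
Qed.

Lemma hneg_em x : hneg x `|` hneg (hneg x) = \top.
Proof. by rewrite -hnegI meetC hnegI0; apply/eqP; rewrite himp_eq1. Qed.

Lemma himpIl x y z : himp (x `&` y) z = himp x z `|` himp y z.
Proof.
apply/le_anti/andP; split; last by rewrite leUx !le_himpl ?leIl ?leIr.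
rewrite -[leLHS]meetx1 -(himp_prelinear x y) meetUr leU2 // -himpP -meetA.
  by apply: le_trans (himp_mp (x `&` y) z); rewrite leI2 // lexI himp_mp leIr.
by apply: le_trans (himp_mp (x `&` y) z); rewrite leI2 // lexI himp_mp leIr.
Qed.

End GodelTheory.

Section DeMorganTheory.
Context {d : Order.disp_t} {T : deMorganType d}.
Implicit Types x y z : T.

Lemma dmnegU x y : dmneg (x `|` y) = dmneg x `&` dmneg y.
Proof. by rewrite -[RHS]dmnegK dmnegI !dmnegK. Qed.

Lemma le_dmneg x y : x <= y -> dmneg y <= dmneg x.
Proof. by move=> /join_idPr <-; rewrite dmnegU leIl. Qed.

Lemma le_dmnegr x y : (x <= dmneg y) = (y <= dmneg x).
Proof. by apply/idP/idP => /le_dmneg; rewrite dmnegK. Qed.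

Lemma le_dmnegl x y : (dmneg x <= y) = (dmneg y <= x).
Proof. by apply/idP/idP => /le_dmneg; rewrite dmnegK. Qed.

Lemma dmneg0 : dmneg \bot = \top :> T.
Proof. by apply/eqP; rewrite -le1x le_dmnegr le0x. Qed.

Lemma dmneg1 : dmneg \top = \bot :> T.
Proof. by rewrite -dmneg0 dmnegK. Qed.

End DeMorganTheory.

(** The Baaz operator: on a chain it fixes [\top] and sends every other element to [\bot]. *)
Definition delta d (T : gSimType d) (x : T) : T := hneg (dmneg x).

Section GSimTheory.
Context {d : Order.disp_t} {T : gSimType d}.
Implicit Types x y z : T.

Lemma delta_le x : delta x <= x.
Proof. by rewrite -[leRHS]dmnegK hneg_le_dmneg. Qed.

Lemma delta_em x : delta x `|` hneg (delta x) = \top.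
Proof. exact: hneg_em. Qed.

Lemma delta1 : delta \top = \top :> T.
Proof. by apply/eqP; rewrite /delta dmneg1 himp_eq1. Qed.

Lemma deltaI x y : delta (x `&` y) = delta x `&` delta y.
Proof. by rewrite /delta dmnegI hnegU. Qed.

Lemma deltaU x y : delta (x `|` y) = delta x `|` delta y.
Proof. by rewrite /delta dmnegU hnegI. Qed.

Lemma le_delta x y : x <= y -> delta x <= delta y.
Proof. by move=> xy; rewrite le_hneg ?le_dmneg. Qed.

(** As [x] is below [dmneg (hneg x)], the meet of [dmneg x] and [x] is below the involute of the
    join of [x] and [hneg x], which is [\bot]. *)
Lemma dmneg_complemented x : x `|` hneg x = \top -> dmneg x = hneg x.
Proof.
move=> xNx; apply/le_anti; rewrite hneg_le_dmneg andbT -hnegP.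
have: dmneg (x `|` hneg x) = \bot by rewrite xNx dmneg1.
rewrite dmnegU => <-; rewrite leI2 //.
by rewrite (le_trans (le_hnegK x)) ?hneg_le_dmneg.
Qed.

Lemma delta_complemented x : x `|` hneg x = \top -> delta x = x.
Proof.
move=> xNx; apply/le_anti; rewrite delta_le /= /delta (dmneg_complemented xNx).
exact: le_hnegK.
Qed.

Lemma deltaK x : delta (delta x) = delta x.
Proof. by rewrite delta_complemented ?delta_em. Qed.

Lemma delta_hneg x : delta (hneg x) = hneg x.
Proof. by rewrite delta_complemented ?hneg_em. Qed.

(** Makes the filter above [hneg (delta x)] proper whenever [x] differs from [\top]. *)
Lemma hneg_delta_eq0 x : (hneg (delta x) == \bot) = (x == \top).
Proof.
apply/eqP/eqP => [Nx|->]; last by rewrite delta1 /hneg himp1x.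
apply/eqP; rewrite -le1x (le_trans _ (delta_le x)) //.
by have := delta_em x; rewrite Nx joinx0 => ->.
Qed.

Lemma delta_himp x y : delta (himp x y) <= himp (delta x) (delta y).
Proof. by rewrite -himpP -deltaI le_delta ?himp_mp. Qed.

(** The complemented element [delta (himp x y)] meets [x] below [y]. Applying [dmneg] puts [dmneg y]
    below the join of its complement and [dmneg x]; a meet with the element cancels the
    complement. *)
Lemma delta_dmneg x y : delta (himp x y) <= delta (himp (dmneg y) (dmneg x)).
Proof.
rewrite -[leLHS]deltaK le_delta // -himpP.
have Ddm : dmneg (delta (himp x y)) = hneg (delta (himp x y)).
  by rewrite dmneg_complemented ?delta_em.
have /le_dmneg : delta (himp x y) `&` x <= y.
  by rewrite himpP delta_le.
rewrite dmnegI Ddm => le_y.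
apply: le_trans (leI2 (lexx _) le_y) _.
by rewrite meetUr [X in X `|` _]meetC hnegI0 join0x leIr.
Qed.

Lemma delta_prelinear x y : delta (himp x y) `|` delta (himp y x) = \top.
Proof. by rewrite -deltaU himp_prelinear delta1. Qed.

End GSimTheory.

(** * Quotients of preordered structures *)

(** A common interface for the two quotients formed later: formulas under provable implication, and
    the amalgam of chains. *)
Record preGSim := PreGSim {
  pcar :> Type;
  ple : pcar -> pcar -> Prop;
  pbot : pcar;
  ptop : pcar;
  pmeet : pcar -> pcar -> pcar;
  pjoin : pcar -> pcar -> pcar;
  pimp : pcar -> pcar -> pcar;
  psim : pcar -> pcar;
  ple_refl : forall x, ple x x;
  ple_trans : forall y x z, ple x y -> ple y z -> ple x z;
  pbot_le : forall x, ple pbot x;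
  ple_top : forall x, ple x ptop;
  ple_meet : forall x y z, ple x (pmeet y z) <-> ple x y /\ ple x z;
  pjoin_le : forall x y z, ple (pjoin x y) z <-> ple x z /\ ple y z;
  pimpP : forall x y z, ple (pmeet x y) z <-> ple x (pimp y z);
  pimp_prelinear : forall x y, ple ptop (pjoin (pimp x y) (pimp y x));
  ple_sim : forall x y, ple x y -> ple (psim y) (psim x);
  psimK : forall x, ple (psim (psim x)) x;
  psimK' : forall x, ple x (psim (psim x));
  pneg_sim : forall x, ple (pimp x pbot) (psim x)
}.

(* The quotient of a preordered structure by mutual comparability; a class is
   represented by the principal down-set of any of its elements. *)
Record gquot (P : preGSim) := GQuot {
  gset : set P;
  gsetP : exists x, gset = [set y | ple y x]
}.

HB.instance Definition _ (P : preGSim) := gen_eqMixin (gquot P).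
HB.instance Definition _ (P : preGSim) := gen_choiceMixin (gquot P).

Definition gcls (P : preGSim) (x : P) : gquot P := GQuot (ex_intro _ x erefl).

Definition grep (P : preGSim) (q : gquot P) : P := projT1 (cid (gsetP q)).

Fact gquot_display : Order.disp_t. Proof. exact: Order.Disp tt tt. Qed.

Section Quotient.
Variable P : preGSim.
Implicit Types (x y : P) (p q r : gquot P).

Lemma gquot_eq p q : gset p = gset q -> p = q.
Proof.
case: p q => [A hA] [B hB] /= AB; case: _ / AB in hB *.
by rewrite (Prop_irrelevance hA hB).
Qed.

Lemma grepK q : gcls (grep q) = q.
Proof. by apply: gquot_eq; rewrite /= /grep; case: cid. Qed.

Definition gle p q : bool := `[< ple (grep p) (grep q) >].

Lemma gcls_eqP x y : gcls x = gcls y <-> ple x y /\ ple y x.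
Proof.
split=> [[]/seteqP[xy yx]|[xy yx]].
  by split; [apply: xy | apply: yx]; apply: ple_refl.
by apply: gquot_eq; apply/seteqP; split=> z /= /ple_trans; apply.
Qed.

Lemma gcls_grep x : ple x (grep (gcls x)) /\ ple (grep (gcls x)) x.
Proof. by apply/gcls_eqP; rewrite grepK. Qed.

Lemma gle_cls x y : gle (gcls x) (gcls y) <-> ple x y.
Proof.
have [xr rx] := gcls_grep x; have [yr ry] := gcls_grep y.
split=> [/asboolP|] le_xy; last apply/asboolP.
  exact: ple_trans xr (ple_trans le_xy ry).
exact: ple_trans rx (ple_trans le_xy yr).
Qed.

Lemma gle_refl : reflexive gle.
Proof. by move=> p; apply/asboolP/ple_refl. Qed.

Lemma gle_anti : antisymmetric gle.
Proof.
move=> p q /andP[/asboolP pq /asboolP qp].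
by rewrite -[p]grepK -[q]grepK; apply/gcls_eqP.
Qed.

Lemma gle_trans : transitive gle.
Proof.
by move=> q p r /asboolP pq /asboolP qr; apply/asboolP/(ple_trans pq qr).
Qed.

HB.instance Definition _ :=
  Order.Le_isPOrder.Build gquot_display (gquot P) gle_refl gle_anti gle_trans.

Lemma leEgquot x y : (gcls x <= gcls y) = `[< ple x y >].
Proof. by apply/idP/asboolP => /gle_cls. Qed.

Lemma ple_grepl p x : ple (grep p) x <-> p <= gcls x.
Proof. by apply: iff_trans (iff_sym (gle_cls _ _)) _; rewrite grepK. Qed.

Lemma ple_grepr x p : ple x (grep p) <-> gcls x <= p.
Proof. by apply: iff_trans (iff_sym (gle_cls _ _)) _; rewrite grepK. Qed.

Definition gmeet p q := gcls (pmeet (grep p) (grep q)).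
Definition gjoin p q := gcls (pjoin (grep p) (grep q)).

Lemma gmeetP p q r : (p <= gmeet q r) = (p <= q) && (p <= r).
Proof.
rewrite -[p in LHS]grepK leEgquot -asbool_and; apply: asbool_equiv_eq.
exact: ple_meet.
Qed.

Lemma gjoinP p q r : (gjoin p q <= r) = (p <= r) && (q <= r).
Proof.
rewrite -[r in LHS]grepK leEgquot -asbool_and; apply: asbool_equiv_eq.
exact: pjoin_le.
Qed.

HB.instance Definition _ :=
  Order.POrder_MeetJoin_isLattice.Build gquot_display (gquot P) gmeetP gjoinP.

Lemma gbotP p : gcls (pbot P) <= p.
Proof. by rewrite -[p]grepK leEgquot; apply/asboolP/pbot_le. Qed.

Lemma gtopP p : p <= gcls (ptop P).
Proof. by rewrite -[p]grepK leEgquot; apply/asboolP/ple_top. Qed.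

HB.instance Definition _ := Order.hasBottom.Build gquot_display (gquot P) gbotP.
HB.instance Definition _ := Order.hasTop.Build gquot_display (gquot P) gtopP.

Definition gimp p q := gcls (pimp (grep p) (grep q)).

Lemma gimpP p q r : (p `&` q <= r) = (p <= gimp q r).
Proof.
rewrite -[r in LHS]grepK -[p in RHS]grepK !leEgquot.
exact/asbool_equiv_eq/pimpP.
Qed.

(** Residuation makes meeting with a fixed element a left adjoint, which preserves joins. *)
Lemma gmeetUl : @left_distributive (gquot P) (gquot P) Order.meet Order.join.
Proof.
move=> p q r; apply/le_anti; rewrite leUx !leI2 ?leUl ?leUr // !andbT.
by rewrite gimpP leUx -!gimpP leUl leUr.
Qed.

HB.instance Definition _ :=
  Order.Lattice_Meet_isDistrLattice.Build gquot_display (gquot P) gmeetUl.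

HB.instance Definition _ := hasHeytingImp.Build gquot_display (gquot P) gimpP.

Lemma gcls_bot : gcls (pbot P) = \bot. Proof. by []. Qed.

Lemma gcls_top : gcls (ptop P) = \top. Proof. by []. Qed.

Lemma gcls_meet x y : gcls (pmeet x y) = gcls x `&` gcls y.
Proof.
have [mx my] := (ple_meet (pmeet x y) x y).1 (ple_refl _).
apply/le_anti/andP; split; first by rewrite lexI !leEgquot !asboolT.
rewrite -[leLHS]grepK leEgquot; apply/asboolP/ple_meet.
by split; apply/ple_grepl; [exact: leIl | exact: leIr].
Qed.

Lemma gcls_join x y : gcls (pjoin x y) = gcls x `|` gcls y.
Proof.
have [xj yj] := (pjoin_le x y (pjoin x y)).1 (ple_refl _).
apply/le_anti/andP; split; last by rewrite leUx !leEgquot !asboolT.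
rewrite -[leRHS]grepK leEgquot; apply/asboolP/pjoin_le.
by split; apply/ple_grepr; [exact: leUl | exact: leUr].
Qed.

Lemma gcls_imp x y : gcls (pimp x y) = himp (gcls x) (gcls y).
Proof.
apply/le_anti/andP; split.
  by rewrite -himpP -gcls_meet leEgquot; apply/asboolP/pimpP/ple_refl.
rewrite -[leLHS]grepK leEgquot; apply/asboolP/pimpP.
have := himp_mp (gcls x) (gcls y).
by rewrite -[X in X `&` _]grepK -gcls_meet leEgquot => /asboolP.
Qed.

Lemma gimp_prelinear p q : himp p q `|` himp q p = \top.
Proof.
rewrite -[p]grepK -[q]grepK -!gcls_imp -gcls_join -gcls_top; apply/eqP.
by rewrite eq_le gtopP leEgquot /=; apply/asboolP/pimp_prelinear.
Qed.

HB.instance Definition _ :=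
  Heyting_isGodel.Build gquot_display (gquot P) gimp_prelinear.

Definition gsim p := gcls (psim (grep p)).

Lemma gcls_sim_subproof x : gcls (psim x) = gsim (gcls x).
Proof.
by have [xr rx] := gcls_grep x; apply/gcls_eqP; split; apply: ple_sim.
Qed.

Lemma gsimK p : gsim (gsim p) = p.
Proof.
rewrite -[p in RHS]grepK -gcls_sim_subproof; apply/gcls_eqP; split.
  exact: psimK.
exact: psimK'.
Qed.

Lemma gle_sim p q : p <= q -> gsim q <= gsim p.
Proof. by move=> /asboolP pq; rewrite leEgquot; apply/asboolP/ple_sim. Qed.

(** An antitone involution is an order anti-automorphism, so it exchanges meets and joins. *)
Lemma gsimI p q : gsim (p `&` q) = gsim p `|` gsim q.
Proof.
apply/le_anti; rewrite leUx !gle_sim ?leIl ?leIr // andbT.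
by rewrite -[leRHS]gsimK gle_sim // lexI -[X in _ <= X]gsimK
  -[X in _ && (_ <= X)]gsimK !gle_sim ?leUl ?leUr.
Qed.

HB.instance Definition _ :=
  hasDeMorganNeg.Build gquot_display (gquot P) gsimK gsimI.

Lemma gcls_sim x : gcls (psim x) = dmneg (gcls x).
Proof. exact: gcls_sim_subproof. Qed.

Lemma gneg_sim p : hneg p <= dmneg p.
Proof.
rewrite -[p]grepK /hneg -gcls_bot -gcls_imp -gcls_sim leEgquot.
exact/asboolP/pneg_sim.
Qed.

HB.instance Definition _ := isGSim.Build gquot_display (gquot P) gneg_sim.

End Quotient.

(** * The Lindenbaum algebra *)

Section Derivations.
Variables (V : Type) (Gamma : set (formula V)).
Implicit Types a b c : formula V.
Local Open Scope modal_scope.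
Local Notation "|- a" := (S5derives Gamma a) (at level 70, a at level 60).

Lemma der_imp_refl a : |- a ⟶ a.
Proof.
apply: der_mp (der_axiom _ (ax_K a a)).
exact: der_mp (der_axiom _ (ax_S a (a ⟶ a) a)) (der_axiom _ (ax_K a (a ⟶ a))).
Qed.

Lemma der_K a b : |- b -> |- a ⟶ b.
Proof. exact/der_mp/der_axiom/ax_K. Qed.

Lemma der_S a b c : |- a ⟶ b ⟶ c -> |- a ⟶ b -> |- a ⟶ c.
Proof.
by move=> abc; apply: der_mp; apply: der_mp (der_axiom _ (ax_S _ _ _)) abc.
Qed.

Lemma der_trans b a c : |- a ⟶ b -> |- b ⟶ c -> |- a ⟶ c.
Proof. by move=> ab /(der_K a) abc; apply: der_S abc ab. Qed.

Lemma der_andP a b c : |- a ⟶ b ∧ c <-> |- a ⟶ b /\ |- a ⟶ c.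
Proof.
split=> [abc|[ab ac]].
  by split; apply: der_trans abc (der_axiom _ _); constructor.
by apply: der_S ac; apply: der_trans ab (der_axiom _ (ax_and _ _)).
Qed.

Lemma der_orP a b c : |- a ∨ b ⟶ c <-> |- a ⟶ c /\ |- b ⟶ c.
Proof.
split=> [abc|[ac bc]].
  by split; apply: der_trans abc; apply: der_axiom; constructor.
exact: der_mp (der_mp (der_axiom _ (ax_or a b c)) ac) bc.
Qed.

Lemma der_impP a b c : |- a ∧ b ⟶ c <-> |- a ⟶ b ⟶ c.
Proof.
split=> abc; last first.
  apply: der_S (der_axiom _ (ax_andr a b)).
  exact: der_trans (der_axiom _ (ax_andl a b)) abc.
apply: der_trans (der_axiom _ (ax_and a b)) _.
exact: der_mp (der_axiom _ (ax_S _ _ _)) (der_K b abc).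
Qed.

Lemma der_equP a b : |- a ≡ b <-> |- a ⟶ b /\ |- b ⟶ a.
Proof.
split=> [ab|[ab ba]].
  by split; apply: der_mp ab; apply: der_axiom; constructor.
exact: der_mp (der_mp (der_axiom _ (ax_and _ _)) ab) ba.
Qed.

Lemma der_simK a : |- ∼ ∼ a ⟶ a /\ |- a ⟶ ∼ ∼ a.
Proof. exact/der_equP/der_axiom/ax_simK. Qed.

Lemma der_DeltaE a : |- Δ a -> |- a.
Proof.
move=> Da; apply: der_mp (der_simK a).1 _.
exact: der_mp (der_axiom _ (ax_neg_sim _)) Da.
Qed.

(** The contraposition axiom speaks of Δ-formulas only, so the Δ rule is applied to the premise and
    Δ is stripped from the conclusion. *)
Lemma der_sim a b : |- a ⟶ b -> |- ∼ b ⟶ ∼ a.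
Proof.
move=> /der_Delta ab; apply: der_DeltaE.
exact: der_mp (der_axiom _ (ax_Delta_sim a b)) ab.
Qed.

Lemma der_topP a : |- Top ⟶ a <-> |- a.
Proof.
split=> [ta|]; last exact: der_K.
by apply: der_mp ta _; apply: der_mp (der_imp_refl a); apply/der_axiom/ax_top.
Qed.

Lemma der_box_imp a b : |- a ⟶ b -> |- □ a ⟶ □ b.
Proof.
move=> ab; apply: der_mp ((der_equP _ _).1 (der_axiom _ (ax_box_box_imp a b))).1 _.
exact/der_nec/(der_trans (der_axiom _ (ax_box a))).
Qed.

Lemma der_dia_imp_box a b : |- a ⟶ □ b -> |- ◇ a ⟶ □ b.
Proof.
move=> /der_nec; apply: der_mp.
exact: ((der_equP _ _).1 (der_axiom _ (ax_box_imp_box a b))).1.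
Qed.

(** An instance of [ax_box_dia_or] with [Bot] as second disjunct, which is dropped again under the
    box. *)
Lemma der_dia_box_dia a : |- ◇ a ⟶ □ ◇ a.
Proof.
have [_ ba] := (der_equP _ _).1 (der_axiom Gamma (ax_box_dia_or a Bot)).
apply: der_trans (der_trans _ ba) _.
  exact/der_axiom/ax_orl.
by apply/der_box_imp/der_orP; split; [exact: der_imp_refl|exact/der_axiom/ax_bot].
Qed.

(** Since [◇ a ⟶ □ ◇ a] is derivable, [ax_box_imp_box] read backwards gives [□ (a ⟶ □ ◇ a)], and
    both boxes can be removed. *)
Lemma der_imp_dia a : |- a ⟶ ◇ a.
Proof.
apply: (@der_trans (□ ◇ a)); last exact/der_axiom/ax_box.
apply: der_mp (der_axiom _ (ax_box _)) _.
apply: der_mp (der_dia_box_dia a).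
exact: ((der_equP _ _).1 (der_axiom _ (ax_box_imp_box a (◇ a)))).2.
Qed.

Lemma der_dia_imp a b : |- a ⟶ b -> |- ◇ a ⟶ ◇ b.
Proof.
move=> ab; apply: der_trans (der_axiom _ (ax_box _)).
apply/der_dia_imp_box/(der_trans ab)/(der_trans (der_imp_dia b)).
exact: der_dia_box_dia.
Qed.

Definition lindenbaum_pre : preGSim.
Proof.
apply: (@PreGSim (formula V) (fun a b => |- a ⟶ b) Bot Top
  (@And V) (@Or V) (@Imp V) (@Sim V)).
- exact: der_imp_refl.
- by move=> b a c; apply: der_trans.
- by move=> a; apply/der_axiom/ax_bot.
- by move=> a; apply/der_axiom/ax_top.
- by move=> a b c; apply: der_andP.
- by move=> a b c; apply: der_orP.
- by move=> a b c; apply: der_impP.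
- by move=> a b; apply/der_topP/der_axiom/ax_prelinear.
- exact: der_sim.
- by move=> a; have [] := der_simK a.
- by move=> a; have [] := der_simK a.
- by move=> a; apply/der_axiom/ax_neg_sim.
Defined.

Definition lindenbaum := gquot lindenbaum_pre.

HB.instance Definition _ := GSim.on lindenbaum.

Definition lcls a : lindenbaum := @gcls lindenbaum_pre a.

Lemma lcls_le a b : (lcls a <= lcls b)%O <-> |- a ⟶ b.
Proof. exact: gle_cls. Qed.

Lemma lcls_eq a b : |- a ≡ b -> lcls a = lcls b.
Proof. by move=> /der_equP ab; apply/gcls_eqP. Qed.

Lemma lcls_eq1 a : (lcls a = \top)%O <-> |- a.
Proof.
rewrite -der_topP -lcls_le -[lcls Top]/(\top : lindenbaum)%O le1x.
by split=> [->|/eqP].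
Qed.

Lemma lcls_and a b : lcls (a ∧ b) = (lcls a `&` lcls b)%O.
Proof. exact: gcls_meet. Qed.

Lemma lcls_or a b : lcls (a ∨ b) = (lcls a `|` lcls b)%O.
Proof. exact: gcls_join. Qed.

Lemma lcls_imp a b : lcls (a ⟶ b) = himp (lcls a) (lcls b).
Proof. exact: gcls_imp. Qed.

Lemma lcls_sim a : lcls (∼ a) = dmneg (lcls a).
Proof. exact: gcls_sim. Qed.

Definition lrep (p : lindenbaum) : formula V := @grep lindenbaum_pre p.

Lemma lrepK p : lcls (lrep p) = p. Proof. exact: grepK. Qed.

Definition lbox (p : lindenbaum) : lindenbaum := lcls (□ lrep p).
Definition ldia (p : lindenbaum) : lindenbaum := lcls (◇ lrep p).

Lemma lcls_box a : lcls (□ a) = lbox (lcls a).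
Proof.
have [ar ra] := @gcls_grep lindenbaum_pre a.
by apply/gcls_eqP; split; apply: der_box_imp.
Qed.

Lemma lcls_dia a : lcls (◇ a) = ldia (lcls a).
Proof.
have [ar ra] := @gcls_grep lindenbaum_pre a.
by apply/gcls_eqP; split; apply: der_dia_imp.
Qed.

Definition lclsE := (lcls_and, lcls_or, lcls_imp, lcls_sim, lcls_box, lcls_dia).

Lemma lbox_M1 p : himp (lbox p) p = \top%O.
Proof. by rewrite -[p]lrepK -!lclsE; apply/lcls_eq1/der_axiom/ax_box. Qed.

Lemma lbox_M2 p q : lbox (himp p (lbox q)) = himp (ldia p) (lbox q).
Proof.
rewrite -[p]lrepK -[q]lrepK -!lclsE.
exact/lcls_eq/der_axiom/ax_box_imp_box.
Qed.

Lemma lbox_M3 p q : lbox (himp (lbox p) q) = himp (lbox p) (lbox q).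
Proof.
rewrite -[p]lrepK -[q]lrepK -!lclsE.
exact/lcls_eq/der_axiom/ax_box_box_imp.
Qed.

Lemma lbox_M4 p q : lbox (ldia p `|` q)%O = (ldia p `|` lbox q)%O.
Proof.
rewrite -[p]lrepK -[q]lrepK -!lclsE.
exact/lcls_eq/der_axiom/ax_box_dia_or.
Qed.

Lemma lbox_Q p : lbox p = dmneg (ldia (dmneg p)).
Proof.
by rewrite -[p]lrepK -!lclsE; apply/lcls_eq/der_axiom/ax_box_sim.
Qed.

HB.instance Definition _ := hasMonadicQuantifiers.Build gquot_display lindenbaum
  lbox_M1 lbox_M2 lbox_M3 lbox_M4 lbox_Q.

Lemma ldia_C (p : lindenbaum) :
  (mexists (p `&` dmneg p) <= mforall (p `|` dmneg p))%O.
Proof.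
rewrite -[p]lrepK -[mexists _]/(ldia _) -[mforall _]/(lbox _) -!lclsE.
exact/lcls_le/der_axiom/ax_dia_box_sim.
Qed.

HB.instance Definition _ := isCMGSim.Build gquot_display lindenbaum ldia_C.

Lemma lcls_morphism : formula_morphism (lcls : formula V -> lindenbaum).
Proof. by split=> // *; rewrite ?lclsE. Qed.

Lemma CMG_complete a : CMGentails Gamma a -> |- a.
Proof.
move=> /(_ _ lindenbaum lcls lcls_morphism) ent; apply/lcls_eq1/ent => g Gg.
exact/lcls_eq1/der_hyp.
Qed.

End Derivations.

(** * Soundness in S5 structures *)

Section Soundness.
Context {V : Type} {K : S5structure V}.
Hypothesis safeK : safe K.
Implicit Types (a b c : formula V) (u v w : world K) (l : degree K).
Local Open Scope modal_scope.

Lemma truth_box_inf a u : infimums (range (truth a)) (truth (□ a) u).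
Proof.
(* The degree at [u] keeps the range nonempty, so [infimum] does not return its default; by safety
   the selected element is a true infimum. *)
have [inf_ex _] := safeK a; rewrite /= /infimum ifF; first exact: xgetPex.
by apply/eqP => /seteqP[+ _] => /(_ (truth a u)); apply; exists u.
Qed.

Lemma truth_dia_sup a u : supremums (range (truth a)) (truth (◇ a) u).
Proof.
have [_ sup_ex] := safeK a; rewrite /= /supremum ifF; first exact: xgetPex.
by apply/eqP => /seteqP[+ _] => /(_ (truth a u)); apply; exists u.
Qed.

Lemma truth_box_le a u v : (truth (□ a) u <= truth a v)%O.
Proof. by have [+ _] := truth_box_inf a u; apply; exists v. Qed.

Lemma truth_le_box a l u : (forall v, l <= truth a v)%O -> (l <= truth (□ a) u)%O.
Proof. by move=> la; have [_] := truth_box_inf a u; apply=> _ [v _ <-]. Qed.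

Lemma truth_dia_ge a u v : (truth a v <= truth (◇ a) u)%O.
Proof. by have [+ _] := truth_dia_sup a u; apply; exists v. Qed.

Lemma truth_dia_le a l u : (forall v, truth a v <= l)%O -> (truth (◇ a) u <= l)%O.
Proof. by move=> la; have [_] := truth_dia_sup a u; apply=> _ [v _ <-]. Qed.

Lemma truth_imp a b w : (truth a w <= truth b w)%O -> truth (a ⟶ b) w = \top%O.
Proof. by move=> ab; apply/eqP; rewrite himp_eq1. Qed.

Lemma truth_equ a b w : truth a w = truth b w -> truth (a ≡ b) w = \top%O.
Proof.
move=> /= ->; apply/eqP; rewrite -le1x lexI andbb le1x.
by rewrite himp_eq1.
Qed.

Arguments truth_box_le : clear implicits.
Arguments truth_le_box {a l} u.
Arguments truth_dia_ge : clear implicits.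
Arguments truth_dia_le {a l} u.
Lemma S5axiom_truth a w : S5axiom a -> truth a w = \top%O.
Proof.
have tot : total (<=%O : rel (degree K)) := @degree_total _ K.
case=> {a}.
- by move=> a b; apply/truth_imp/le_himpr.
- move=> a b c; apply: truth_imp; rewrite /= -!himpP.
  set x := truth a w; set y := truth b w; set z := truth c w.
  have le_y : (himp x (himp y z) `&` himp x y `&` x <= y)%O.
    by apply: le_trans (himp_mp x y); rewrite leI2 ?leIr.
  have le_yz : (himp x (himp y z) `&` himp x y `&` x <= himp y z)%O.
    by apply: le_trans (himp_mp x (himp y z)); rewrite leI2 ?leIl.
  by apply: le_trans (himp_mp y z); rewrite lexI le_yz.
- by move=> a b; apply/truth_imp/leIl.
- by move=> a b; apply/truth_imp/leIr.
- by move=> a b; apply: truth_imp; rewrite /= -himpP.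
- by move=> a b; apply/truth_imp/leUl.
- by move=> a b; apply/truth_imp/leUr.
- by move=> a b c; apply: truth_imp; rewrite /= -himpP himpUl.
- by move=> a; apply/truth_imp/le0x.
- by move=> a; apply/truth_imp/lex1.
- by move=> a b; apply: himp_prelinear.
- by move=> a; apply: truth_imp; apply: (truth_box_le _ w).
- move=> a b; apply: truth_equ; apply/le_anti/andP; split.
    rewrite -himpP meetC himpP; apply: (truth_dia_le w) => v.
    by rewrite -himpP meetC himpP; apply: (truth_box_le _ w).
  apply: (truth_le_box w) => v; rewrite -himpP.
  rewrite (le_trans _ (himp_mp (truth (◇ a) w) _)) // leI2 //.
  exact: (truth_dia_ge _ w).
- move=> a b; apply: truth_equ; apply/le_anti/andP; split.
    rewrite -himpP; apply: (truth_le_box w) => v.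
    by rewrite himpP; apply: (truth_box_le (□ a ⟶ b)).
  apply: (truth_le_box w) => v; rewrite -himpP.
  rewrite (le_trans (himp_mp (truth (□ a) w) _)) //.
  exact: (truth_box_le _ w).
- move=> a b; apply: truth_equ; apply/le_anti/andP; split; last first.
    apply: (truth_le_box w) => v; rewrite leUx leUl (le_trans _ (leUr _ _)) //.
    exact: (truth_box_le _ w).
  (* On a chain, if [l] is not below the degree of [◇ a], then at every world the bound [l] on the
     disjunction must come from [b]. *)
  set l := truth (□ _) w.
  have /orP[l_dia|dia_l] := tot l (truth (◇ a) w).
    by rewrite (le_trans l_dia) ?leUl.
  have [l_dia|not_l_dia] := boolP (l <= truth (◇ a) w)%O.
    by rewrite (le_trans l_dia) ?leUl.
  rewrite (le_trans _ (leUr _ _)) //; apply: (truth_le_box w) => v.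
  have := truth_box_le (◇ a ∨ b) w v; rewrite -/l /=.
  have /orP[/join_idPl|/join_idPr] := tot (truth b v) (truth (◇ a) v) => [|->] //.
  by move=> /= ->; rewrite (negPf not_l_dia).
- by move=> a; apply: truth_equ; apply: dmnegK.
- by move=> a; apply/truth_imp/hneg_le_dmneg.
- by move=> a b; apply/truth_imp/delta_dmneg.
- by move=> a; apply: delta_em.
- move=> a b; apply: truth_imp.
  by rewrite [leLHS](deltaU (truth a w) (truth b w)).
- by move=> a b; apply/truth_imp/delta_himp.
- move=> a; apply: truth_equ; apply/le_anti/andP; split.
    rewrite [truth (∼ _) w]/= -[dmneg _]/(dmneg (truth (◇ ∼ a) w)) le_dmnegr.
    by apply: (truth_dia_le w) => v; rewrite le_dmneg ?(truth_box_le a w v).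
  apply: (truth_le_box w) => v; rewrite -[leLHS]/(dmneg (truth (◇ ∼ a) w)) le_dmnegl.
  exact: (truth_dia_ge (∼ a) w v).
- move=> a; apply: truth_imp. apply: (truth_dia_le w) => v.
  apply: (truth_le_box w) => u /=.
  (* If the degree of [a] grows from [v] to [u], the bound goes through [a]; otherwise that of [∼ a]
     grows, and the bound goes through [∼ a]. *)
  have /orP[vu|uv] := tot (truth a v) (truth a u).
    by rewrite (le_trans (leIl _ _)) ?(le_trans vu) ?leUl.
  by rewrite (le_trans (leIr _ _)) ?(le_trans (le_dmneg uv)) ?leUr.
Qed.

End Soundness.

Lemma S5_sound V (Gamma : set (formula V)) a :
  S5derives Gamma a -> S5entails Gamma a.
Proof.
move=> der_a K [safeK Gamma1].
elim: der_a => {a} [a Ga|a ax|a b _ IHab _ IHa|a _ IHa|a _ IHa] w.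
- exact: Gamma1.
- exact: S5axiom_truth.
- by have := IHab w; rewrite /= IHa himp1x.
- by apply/eqP; rewrite -le1x truth_le_box // => v; rewrite IHa.
- by rewrite /Delta /Neg /= -/(hneg _) IHa -[RHS]delta1.
Qed.

(** * Ultrafilters and localizations *)

(** Closure under [delta] makes the preorder [F (himp x y)] compatible with [dmneg]; see
    [dle_dmneg]. *)
Record delta_filter d (T : gSimType d) (F : set T) : Prop := {
  dfilter1 : F \top;
  dfilterI : forall x y, F x -> F y -> F (x `&` y);
  dfilterS : forall x y, x <= y -> F x -> F y;
  dfilter_delta : forall x, F x -> F (delta x)
}.

(** The dichotomy negates [delta x], which is complemented, whereas [x] may fail to be. *)
Record delta_ultrafilter d (T : gSimType d) (F : set T) : Prop := {
  dultra_filter :> delta_filter F;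
  dultra0 : ~ F \bot;
  dultra_em : forall x, F x \/ F (hneg (delta x))
}.

Lemma delta_ultrafilterP d (T : gSimType d) (G : set T) :
  delta_filter G -> ~ G \bot -> exists2 F, delta_ultrafilter F & G `<=` F.
Proof.
move=> filG G0.
pose proper (F : set T) := delta_filter F /\ ~ F \bot.
(* With [G] joined to [X], the empty set satisfies [P], as the union of an empty chain must. *)
pose P X := proper (X `|` G)%classic.
have [X S totS|M [[filM M0] maxM]] := @Zorn_bigcup T P.
  have [[X0 SX0]|nS] := pselect (exists X0, X X0); last first.
    suff -> : \bigcup_(Y in X) Y = set0.
      by rewrite /P set0U.
    by rewrite -subset0 => y [Y XY _]; apply: nS; exists Y.
  have dir x y : (\bigcup_(Y in X) Y `|` G)%classic x ->
      (\bigcup_(Y in X) Y `|` G)%classic y ->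
      exists2 Y, X Y & (Y `|` G)%classic x /\ (Y `|` G)%classic y.
    move=> [[Y1 XY1 Y1x]|Gx] [[Y2 XY2 Y2y]|Gy].
    - have [Y12|Y21] := totS _ _ XY1 XY2.
        by exists Y2 => //; split; left => //; apply: Y12.
      by exists Y1 => //; split; left => //; apply: Y21.
    - by exists Y1 => //; split; [left | right].
    - by exists Y2 => //; split; [right | left].
    - by exists X0 => //; split; right.
  have up Y : X Y -> (Y `|` G `<=` \bigcup_(Y in X) Y `|` G)%classic.
    by move=> XY y [Yy|Gy]; [left; exists Y | right].
  split; last by move=> h; have [Y /S[_ Y0] [/Y0]] := dir _ _ h h.
  split; first by right; apply: dfilter1.
  - move=> x y Ux Uy; have [Y XY [Yx Yy]] := dir _ _ Ux Uy.
    by apply: (up _ XY); have [filY _] := S _ XY; apply: (dfilterI filY).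
  - move=> x y xy Ux; have [Y XY [Yx _]] := dir _ _ Ux Ux.
    by apply: (up _ XY); have [filY _] := S _ XY; apply: dfilterS xy Yx.
  - move=> x Ux; have [Y XY [Yx _]] := dir _ _ Ux Ux.
    by apply: (up _ XY); have [filY _] := S _ XY; apply: dfilter_delta.
exists (M `|` G)%classic; last by move=> x Gx; right.
split=> // x; apply: contrapT => /not_orP[Nx NDx].
(* The filter generated by the maximal one and [delta x]. If it were improper, some [g] in the
   maximal filter would be below [hneg (delta x)], against [NDx]. *)
pose N := [set y | exists2 g, (M `|` G)%classic g & g `&` delta x <= y].
have MN : (M `|` G `<=` N)%classic by move=> y My; exists y => //; apply: leIl.
have Nx' : N x by exists \top; [exact: dfilter1 filM | rewrite meet1x delta_le].
have NG : (N `|` G = N)%classic.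
  by apply/seteqP; split=> [y [//|Gy]|y]; [apply: MN; right | left].
apply: (maxM N).
  split=> [y My|NM]; first by apply: MN; left.
  by apply: Nx; left; apply: NM.
rewrite /P NG; split; last first.
  by move=> [g Mg]; rewrite hnegP => gx; apply/NDx/(dfilterS filM gx).
split; first exact/MN/(dfilter1 filM).
- move=> y z [g Mg gy] [h Mh hz]; exists (g `&` h); first exact: dfilterI.
  by rewrite lexI (le_trans _ gy) ?(le_trans _ hz) ?leI2 ?leIl ?leIr.
- by move=> y z yz [g Mg gy]; exists g; last exact: le_trans yz.
- move=> y [g Mg gy]; exists (delta g); first exact: dfilter_delta.
  by rewrite -[delta x]deltaK -deltaI le_delta.
Qed.

Section Ultrafilter.
Context {d : Order.disp_t} {T : gSimType d} {F : set T}.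
Hypothesis ultraF : delta_ultrafilter F.
Implicit Types x y z : T.
Local Notation "x <=_F y" := (F (himp x y)) (at level 70).

Lemma dultraNP x : ~ F x <-> F (hneg (delta x)).
Proof.
split=> [|FN Fx]; first by case: (dultra_em ultraF x).
apply: (dultra0 ultraF); rewrite -(hnegI0 (delta x)).
exact: dfilterI ultraF _ _ FN (dfilter_delta ultraF Fx).
Qed.

Lemma dultraU x y : F (delta x `|` delta y) -> F x \/ F y.
Proof.
move=> Fxy; apply: contrapT => /not_orP[/dultraNP Nx /dultraNP Ny].
apply: (dultra0 ultraF); rewrite -(hnegI0 (delta x `|` delta y)).
by rewrite hnegU; do 2!apply: (dfilterI ultraF) => //.
Qed.

Lemma dle_total x y : x <=_F y \/ y <=_F x.
Proof. by apply: dultraU; rewrite delta_prelinear; apply: dfilter1 ultraF. Qed.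

Lemma le_dle x y : x <= y -> x <=_F y.
Proof. by rewrite -himp_eq1 => /eqP ->; apply: dfilter1 ultraF. Qed.

Lemma dle_refl x : x <=_F x. Proof. exact: le_dle. Qed.

Lemma dle_trans y x z : x <=_F y -> y <=_F z -> x <=_F z.
Proof.
by move=> xy yz; apply: (dfilterS ultraF (himp_comp x y z)); apply: (dfilterI ultraF).
Qed.

Lemma dle_dmneg x y : x <=_F y -> dmneg y <=_F dmneg x.
Proof.
move=> /(dfilter_delta ultraF); apply: (dfilterS ultraF).
exact: le_trans (delta_dmneg x y) (delta_le _).
Qed.

Lemma dle1 x : \top <=_F x <-> F x.
Proof. by rewrite himp1x. Qed.

(** By totality either [himp x y] is below [x], and modus ponens yields [y], or [x] is below
    [himp x y], and contraction contradicts the hypothesis. *)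
Lemma dle_himp x y : ~ x <=_F y -> himp x y <=_F y.
Proof.
move=> nxy; have [gx|xg] := dle_total (himp x y) x; last first.
  case: nxy; apply: (dfilterS ultraF _ xg).
  rewrite -himpP -[X in _ `&` X]meetxx meetA.
  by apply: le_trans (himp_mp x y); rewrite leI2 ?himp_mp.
apply: (dfilterS ultraF _ gx); rewrite -himpP.
apply: le_trans (himp_mp x y); rewrite lexI leIr /=.
exact: himp_mp.
Qed.

(** Modulo [F], if [x] is below [dmneg x] then it equals their meet, which is below [y]; otherwise
    it equals their join, which is above [dmneg y]. *)
Lemma dle_dmneg_join x y : x `&` dmneg x <= y -> x <=_F y \/ dmneg y <=_F x.
Proof.
move=> xxy; have [xx|xx] := dle_total x (dmneg x).
  left; apply: dle_trans (le_dle xxy); apply: (dfilterS ultraF _ xx).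
  by rewrite -himpI -[leLHS]meet1x leI2 // le1x himp_eq1.
right; have /le_dle nyx := le_dmneg xxy; apply: dle_trans nyx _.
rewrite dmnegI dmnegK himpUl.
by apply: (dfilterI ultraF) => //; apply: dle_refl.
Qed.

End Ultrafilter.

(** * Chains as quotients of total preorders with an involution *)

Section ChainQuotient.
Context {T : Type} (le : T -> T -> Prop) (bot top : T) (sim : T -> T).
Hypotheses (le_refl : forall x, le x x)
  (le_trans : forall y x z, le x y -> le y z -> le x z)
  (le_total : forall x y, le x y \/ le y x)
  (bot_le : forall x, le bot x) (le_top : forall x, le x top)
  (le_sim : forall x y, le x y -> le (sim y) (sim x))
  (simK : forall x, le (sim (sim x)) x) (simK' : forall x, le x (sim (sim x))).

(** Totality forces the operations: meet and join select an argument, and implication yields [top]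
    or its conclusion. *)
Definition chain_pre : preGSim.
Proof.
apply: (@PreGSim T le bot top (fun x y => if `[< le x y >] then x else y)
  (fun x y => if `[< le x y >] then y else x)
  (fun x y => if `[< le x y >] then top else y) sim) => //.
- move=> x y z; case: asboolP => yz; split=> [xy|[]] //; split=> //.
    exact: le_trans xy yz.
  by have [/yz|] := le_total y z; last exact: le_trans.
- move=> x y z; case: asboolP => xy; split=> [yz|[]] //; split=> //.
    exact: le_trans xy yz.
  by have [/xy|yx] := le_total x y; last exact: le_trans yx yz.
- move=> x y z; case: (asboolP (le y z)) => yz; case: asboolP => xy; split=> // h.
  + exact: le_trans xy yz.
  + case: yz; have [/xy//|yx] := le_total x y; exact: le_trans yx h.
- move=> x y; case: (asboolP (le x y)) => xy; first by case: asboolP.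
  by have [/xy//|yx] := le_total x y; rewrite (asboolT yx); case: asboolP.
(* The pseudo-complement is [bot] unless [x] is below [bot]. In that case [x] is below [sim top],
   and antitonicity places [top] below [sim x]. *)
- move=> x; case: asboolP => [xb|_]; last exact: bot_le.
  apply: le_trans (simK' _) _; apply: le_sim; apply: le_trans xb (bot_le _).
Defined.

Lemma chain_quot_total : total (<=%O : rel (gquot chain_pre)).
Proof.
move=> p q; rewrite -[p]grepK -[q]grepK !leEgquot.
by apply/orP; have [pq|qp] := le_total (grep p) (grep q); [left|right]; apply/asboolP.
Qed.

End ChainQuotient.

(** * Maps from an algebra to a chain that realize the preorder of an ultrafilter *)

Section Localization.
Context {d : Order.disp_t} {A : gSimType d} {F : set A}.
Hypothesis ultraF : delta_ultrafilter F.
Context {d' : Order.disp_t} {L : gSimType d'} (f : A -> L).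
Hypothesis totalL : total (<=%O : rel L).
Hypothesis f_le : forall x y, f x <= f y <-> F (himp x y).
Hypotheses (f0 : f \bot = \bot) (f1 : f \top = \top).

Lemma localization_eq x y : F (himp x y) -> F (himp y x) -> f x = f y.
Proof. by move=> /f_le xy /f_le yx; apply/le_anti; rewrite xy. Qed.

(** Modulo [F] any two elements are comparable, so the meet is one of them, selected in the same way
    on both sides of [f]. *)
Lemma localization_meet x y : f (x `&` y) = f x `&` f y.
Proof.
wlog xy : x y / F (himp x y).
  move=> th; have [/th //|/th yx] := dle_total ultraF x y.
  by rewrite meetC yx meetC.
rewrite (meet_idPl ((f_le x y).2 xy)); apply: localization_eq.
  exact/(le_dle ultraF)/leIl.
by rewrite -himpI; apply: (dfilterI ultraF); first exact: dle_refl.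
Qed.

Lemma localization_join x y : f (x `|` y) = f x `|` f y.
Proof.
wlog xy : x y / F (himp x y).
  move=> th; have [/th //|/th yx] := dle_total ultraF x y.
  by rewrite joinC yx joinC.
rewrite (join_idPr ((f_le x y).2 xy)); apply: localization_eq.
  by rewrite himpUl; apply: (dfilterI ultraF); last exact: dle_refl.
exact/(le_dle ultraF)/leUr.
Qed.

(** Both sides are [\top] when [x] is below [y] modulo [F], and [f y] otherwise. *)
Lemma localization_himp x y : f (himp x y) = himp (f x) (f y).
Proof.
have [xy|nxy] := pselect (F (himp x y)).
  have /eqP -> : himp (f x) (f y) == \top by rewrite himp_eq1; apply/f_le.
  rewrite -f1; apply: localization_eq; last by apply/dle1.
  exact/(le_dle ultraF)/lex1.
have -> : himp (f x) (f y) = f y.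
  apply/le_anti; rewrite le_himpr andbT.
  have nfxy : ~~ (f x <= f y) by apply/negP => /f_le.
  have := himp_mp (f x) (f y).
  have /orP[/meet_idPl -> //|/meet_idPr ->] := totalL (himp (f x) (f y)) (f x).
  by rewrite (negPf nfxy).
apply: localization_eq; first exact: dle_himp.
exact/(le_dle ultraF)/le_himpr.
Qed.

End Localization.

(** * Amalgamation of the localizations *)

Section Amalgam.
Context {d : Order.disp_t} {A : gSimType d} {I : Type}.
Variables (w : I -> set A) (C : set A) (lti : I -> I -> Prop) (i0 : I).
Hypothesis ultra_w : forall i, delta_ultrafilter (w i).
Hypotheses (C0 : C \bot) (C1 : C \top) (C_dmneg : forall c, C c -> C (dmneg c)).
Hypothesis C_agree : forall c e i j,
  C c -> C e -> w i (himp c e) -> w j (himp c e).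
Hypothesis C_middle : forall x, exists2 c, C c &
  c <= dmneg c /\ x `&` dmneg x <= c.
Hypotheses (lti_irr : forall i, ~ lti i i)
  (lti_trans : forall j i k, lti i j -> lti j k -> lti i k)
  (lti_total : forall i j, [\/ lti i j, i = j | lti j i]).
Implicit Types (x y z : I * A) (i j : I) (a b c e : A).
Local Notation "a <=[ i ] b" := (w i (himp a b)) (at level 70).

(** A pair [(i, a)] stands for the class of [a] in the localization at [w i]. Both halves of its cut
    are recorded, since a base element and an element just above it can have the same lower cut. *)
Definition lower_cut x : set A := [set c | C c /\ c <=[x.1] x.2].
Definition upper_cut x : set A := [set c | C c /\ x.2 <=[x.1] c].

Definition cut_le x y : Prop :=
  (lower_cut x `<=` lower_cut y)%classic /\ (upper_cut y `<=` upper_cut x)%classic.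

Definition in_base x : Prop := exists2 c, lower_cut x c & upper_cut x c.

(** Outside the base exactly one of [x] and its involute has this property, by [upper_half_or] and
    [upper_half_both]. *)
Definition upper_half x : Prop := exists2 c, lower_cut x c & dmneg c <= c.

(* Inside a cut of [C] the localizations are stacked according to their index,
   in opposite directions in the two halves, so that the involution, which
   keeps the index and exchanges the two halves, is antitone. *)
Definition tie_le x y : Prop :=
  [\/ in_base x, x.1 = y.1 /\ x.2 <=[x.1] y.2,
      upper_half x /\ lti x.1 y.1 | ~ upper_half x /\ lti y.1 x.1].

(** A lexicographic order: cuts are compared first, and [tie_le] decides inside a cut. *)
Definition amalgam_le x y : Prop := cut_le x y /\ (cut_le y x -> tie_le x y).

Lemma cut_le_trans y x z : cut_le x y -> cut_le y z -> cut_le x z.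
Proof.
move=> [xy yx] [yz zy].
by split; [apply: subset_trans xy yz | apply: subset_trans zy yx].
Qed.

(** The order of base elements is the same at all indices by [C_agree], so comparisons through [c]
    transfer from one localization to the other. *)
Lemma between_cut_le x y c : upper_cut x c -> lower_cut y c -> cut_le x y.
Proof.
move=> [Cc xc] [_ cy]; split=> e [Ce h]; split=> //.
  apply: (dle_trans (ultra_w y.1) _ cy).
  exact: C_agree (dle_trans (ultra_w x.1) h xc).
apply: (dle_trans (ultra_w x.1) xc).
exact: C_agree (dle_trans (ultra_w y.1) cy h).
Qed.

(** A failed inclusion of cuts yields a base element that separates [y] from [x] in the opposite
    direction. *)
Lemma cut_le_total x y : cut_le x y \/ cut_le y x.
Proof.
have [xy|nxy] := pselect (cut_le x y); [by left | right].
have [/existsNP[c /not_implyP[xc nyc]]|/existsNP[c /not_implyP[yc nxc]]] :=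
  (not_andP _ _).1 nxy.
  have [Cc _] := xc; apply: (between_cut_le _ xc); split=> //.
  by have [cy|//] := dle_total (ultra_w y.1) c y.2; case: nyc.
have [Cc _] := yc; apply: (between_cut_le yc); split=> //.
by have [xc|//] := dle_total (ultra_w x.1) x.2 c; case: nxc.
Qed.

Lemma cut_le_idx i a b : a <=[i] b -> cut_le (i, a) (i, b).
Proof.
move=> ab; split=> c [Cc h]; split=> //=.
  exact: (dle_trans (ultra_w i) h).
exact: (dle_trans (ultra_w i) ab).
Qed.

Lemma in_base_cut x y : cut_le x y -> cut_le y x -> in_base x -> in_base y.
Proof. by move=> [xy _] [_ xy'] [c xc cx]; exists c; [apply: xy | apply: xy']. Qed.

Lemma upper_half_cut x y : cut_le x y -> upper_half x -> upper_half y.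
Proof. by move=> [xy _] [c xc c_ge]; exists c => //; apply: xy. Qed.

Lemma amalgam_le_refl x : amalgam_le x x.
Proof.
split; first by split.
by move=> _; apply: Or42; split=> //; apply: dle_refl.
Qed.

Lemma amalgam_le_trans y x z : amalgam_le x y -> amalgam_le y z -> amalgam_le x z.
Proof.
move=> [xy txy] [yz tyz]; split; first exact: cut_le_trans xy yz.
(* Now all three elements share one cut, hence the same half and the same status in the base;
   opposite stacking directions cannot be combined. *)
move=> zx; have yx := cut_le_trans yz zx; have zy := cut_le_trans zx xy.
have hxy := upper_half_cut xy; have hyx := upper_half_cut yx.
case: (txy yx) => [bx|[i1 x1]|[hx l1]|[nx l1]]; first exact: Or41.
- case: (tyz zy) => [bx|[i2 x2]|[hy l2]|[ny l2]].
  + by apply: Or41; apply: in_base_cut bx.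
  + apply: Or42; split; first exact: etrans i2.
    by apply: (dle_trans (ultra_w _) x1); rewrite i1.
  + by apply: Or43; rewrite i1; split; first exact: hyx.
  + by apply: Or44; rewrite i1; split=> // /hxy.
- case: (tyz zy) => [bx|[i2 x2]|[hy l2]|[ny l2]].
  + by apply: Or41; apply: in_base_cut bx.
  + by apply: Or43; rewrite -i2.
  + by apply: Or43; split=> //; apply: lti_trans l2.
  + by case: ny; apply: hxy.
- case: (tyz zy) => [bx|[i2 x2]|[hy l2]|[ny l2]].
  + by apply: Or41; apply: in_base_cut bx.
  + by apply: Or44; rewrite -i2.
  + by case: nx; apply: hyx.
  + by apply: Or44; split=> //; apply: lti_trans l1.
Qed.

Lemma amalgam_le_total x y : amalgam_le x y \/ amalgam_le y x.
Proof.
have [xy|nxy] := pselect (cut_le x y); last first.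
  by right; have [//|yx] := cut_le_total x y; split.
have [yx|nyx] := pselect (cut_le y x); last by left; split.
suff [t|t] : tie_le x y \/ tie_le y x by [left | right].
have [hx|hx] := pselect (upper_half x);
    case: (lti_total x.1 y.1) => [lxy|exy|lyx].
- by left; apply: Or43.
- have [le|le] := dle_total (ultra_w x.1) x.2 y.2; first by left; apply: Or42.
  by right; apply: Or42; rewrite -exy.
- by right; apply: Or43; split=> //; apply: upper_half_cut hx.
- by right; apply: Or44; split=> // /(upper_half_cut yx).
- have [le|le] := dle_total (ultra_w x.1) x.2 y.2; first by left; apply: Or42.
  by right; apply: Or42; rewrite -exy.
- by left; apply: Or44.
Qed.

Definition amalgam_dmneg x : I * A := (x.1, dmneg x.2).

Lemma amalgam_dmnegK x : amalgam_dmneg (amalgam_dmneg x) = x.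
Proof. by case: x => i a; rewrite /amalgam_dmneg /= dmnegK. Qed.

Lemma lower_cut_dmneg x c : upper_cut x c -> lower_cut (amalgam_dmneg x) (dmneg c).
Proof. by move=> [Cc xc]; split; [exact: C_dmneg | exact: dle_dmneg]. Qed.

Lemma upper_cut_dmneg x c : lower_cut x c -> upper_cut (amalgam_dmneg x) (dmneg c).
Proof. by move=> [Cc xc]; split; [exact: C_dmneg | exact: dle_dmneg]. Qed.

Lemma cut_le_dmneg x y : cut_le x y -> cut_le (amalgam_dmneg y) (amalgam_dmneg x).
Proof.
move=> [xy yx]; split=> c.
  move=> /upper_cut_dmneg; rewrite amalgam_dmnegK => /yx /lower_cut_dmneg.
  by rewrite dmnegK.
move=> /lower_cut_dmneg; rewrite amalgam_dmnegK => /xy /upper_cut_dmneg.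
by rewrite dmnegK.
Qed.

Lemma in_base_dmneg x : in_base x -> in_base (amalgam_dmneg x).
Proof.
move=> [c xc cx]; exists (dmneg c).
  exact: lower_cut_dmneg.
exact: upper_cut_dmneg.
Qed.

(** The use of [C_middle], the trace of axiom (C): modulo the ultrafilter, [x] is below the given
    [c] or above [dmneg c], and [dmneg c] witnesses an upper half. *)
Lemma upper_half_or x : upper_half x \/ upper_half (amalgam_dmneg x).
Proof.
have [c Cc [c_le xxc]] := C_middle x.2.
have c_le' : dmneg (dmneg c) <= dmneg c by rewrite dmnegK.
have [xc|cx] := dle_dmneg_join (ultra_w x.1) xxc.
  right; exists (dmneg c) => //.
  exact: lower_cut_dmneg.
by left; exists (dmneg c) => //; split; first exact: C_dmneg.
Qed.

(** With witnesses [c] and [e], the cycle [dmneg e], [e], [dmneg c], [c], [x], [dmneg e] is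
    increasing modulo the ultrafilter, so [x] coincides with the base element [dmneg e]. *)
Lemma upper_half_both x : upper_half x -> upper_half (amalgam_dmneg x) -> in_base x.
Proof.
move=> [c xc c_ge] [e /upper_cut_dmneg]; rewrite amalgam_dmnegK => xe e_ge.
exists (dmneg e) => //; have [Cc cx] := xc; have [Ce ex] := xe.
split=> //.
apply: (dle_trans (ultra_w x.1) _ cx).
apply: (dle_trans (ultra_w x.1) (le_dle (ultra_w x.1) e_ge)).
apply: (dle_trans (ultra_w x.1) _ (le_dle (ultra_w x.1) c_ge)).
rewrite -[e in X in w _ X]dmnegK; apply: (dle_dmneg (ultra_w x.1)).
exact: (dle_trans (ultra_w _) cx ex).
Qed.

Lemma amalgam_le_dmneg x y :
  amalgam_le x y -> amalgam_le (amalgam_dmneg y) (amalgam_dmneg x).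
Proof.
move=> [xy txy]; split; first exact: cut_le_dmneg.
move=> /cut_le_dmneg; rewrite !amalgam_dmnegK => yx.
(* Outside the base the involution exchanges the two halves, so the two index clauses of [tie_le]
   are swapped. *)
have [by_|nby] := pselect (in_base y); first exact/Or41/in_base_dmneg.
case: (txy yx) => [bx|[exy le_xy]|[hx l]|[nhx l]].
- by case: nby; apply: in_base_cut bx.
- by apply: Or42; split=> //=; apply: dle_dmneg => //; rewrite -exy.
- apply: Or44; split=> // /(upper_half_both (upper_half_cut xy hx)).
  exact: nby.
- apply: Or43; split=> //; have [/(upper_half_cut yx)//|//] := upper_half_or y.
Qed.

(** This glues the localizations: the copies of a base element at different indices become
    equivalent. *)
Lemma amalgam_le_base i j c e : C c -> C e -> c <=[i] e -> amalgam_le (i, c) (j, e).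
Proof.
move=> Cc Ce ce; have base_c : lower_cut (i, c) c /\ upper_cut (i, c) c.
  by split; split=> //; apply: dle_refl.
split=> [|_]; last by apply: Or41; exists c; case: base_c.
apply: (@between_cut_le _ _ c); first by case: base_c.
by split=> //=; apply: C_agree ce.
Qed.

(** Each localization embeds. If also [b] is below [a], the cuts agree and [tie_le] applies: its
    index clauses contradict irreflexivity, and in the base clause the witness lies between [a] and
    [b]. *)
Lemma amalgam_leP i a b : amalgam_le (i, a) (i, b) <-> a <=[i] b.
Proof.
split=> [[ab tab]|ab]; last first.
  by split=> [|_]; [exact: cut_le_idx | apply: Or42].
have [//|ba] := dle_total (ultra_w i) a b.
case: (tab (cut_le_idx ba)) =>
  [[c [Cc ca] ac]|[_ //]|[_ /lti_irr //]|[_ /lti_irr //]].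
have [_ cb] : lower_cut (i, b) c by apply: ab.1.
by case: ac => _ ac; apply: (dle_trans (ultra_w _) ac cb).
Qed.

Lemma amalgam_bot_le x : amalgam_le (i0, \bot) x.
Proof.
apply: (@amalgam_le_trans (x.1, \bot)).
  by apply: amalgam_le_base => //; apply: dle_refl.
by case: x => i a; apply/amalgam_leP/le_dle.
Qed.

Lemma amalgam_le_top x : amalgam_le x (i0, \top).
Proof.
apply: (@amalgam_le_trans (x.1, \top)); last first.
  by apply: amalgam_le_base => //; apply: dle_refl.
by case: x => i a; apply/amalgam_leP/le_dle => //; apply: lex1.
Qed.

Definition amalgam_pre : preGSim := chain_pre amalgam_le_refl amalgam_le_trans
  amalgam_le_total amalgam_bot_le amalgam_le_top amalgam_le_dmneg
  (fun x => eq_ind_r (amalgam_le^~ x) (amalgam_le_refl x) (amalgam_dmnegK x))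
  (fun x => eq_ind_r (amalgam_le x) (amalgam_le_refl x) (amalgam_dmnegK x)).

Definition amalgam := gquot amalgam_pre.
HB.instance Definition _ := GSim.on amalgam.

Lemma amalgam_total : total (<=%O : rel amalgam).
Proof. exact: chain_quot_total. Qed.

Definition amalgam_inj i a : amalgam := @gcls amalgam_pre (i, a).

Lemma amalgam_inj_le i j a b :
  amalgam_inj i a <= amalgam_inj j b <-> amalgam_le (i, a) (j, b).
Proof. exact: gle_cls. Qed.

Lemma amalgam_inj_idx i a b : amalgam_inj i a <= amalgam_inj i b <-> a <=[i] b.
Proof. by rewrite amalgam_inj_le amalgam_leP. Qed.

Lemma amalgam_inj_base i j c : C c -> amalgam_inj i c = amalgam_inj j c.
Proof.
by move=> Cc; apply/gcls_eqP; split; apply: amalgam_le_base => //; apply: dle_refl.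
Qed.

Lemma amalgam_surj (q : amalgam) : exists i a, q = amalgam_inj i a.
Proof.
exists (grep q).1, (grep q).2; rewrite -[LHS]grepK /amalgam_inj.
by case: (grep q).
Qed.

Lemma amalgam_inj0 i : amalgam_inj i \bot = \bot.
Proof. by rewrite (amalgam_inj_base i i0 C0). Qed.

Lemma amalgam_inj1 i : amalgam_inj i \top = \top.
Proof. by rewrite (amalgam_inj_base i i0 C1). Qed.

Lemma amalgam_inj_dmneg i a : amalgam_inj i (dmneg a) = dmneg (amalgam_inj i a).
Proof. exact: (@gcls_sim amalgam_pre (i, a)). Qed.

End Amalgam.

(** * Representation of CMG-algebras *)

Section MonadicTheory.
Context {d : Order.disp_t} {A : cmgSimType d}.
Implicit Types x y c e : A.

Definition fixed_base : set A := [set c | mforall c = c].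

Lemma mforall_le x : mforall x <= x.
Proof. by rewrite -himp_eq1 monM1. Qed.

Lemma mexistsE x : mexists x = dmneg (mforall (dmneg x)).
Proof. by rewrite monQ !dmnegK. Qed.

Lemma mexists_ge x : x <= mexists x.
Proof. by rewrite mexistsE le_dmnegr mforall_le. Qed.

Lemma mforall1 : mforall \top = \top :> A.
Proof.
have := monM3 (\top : A) \top; rewrite monM1 => ->.
by apply/eqP; rewrite himp_eq1.
Qed.

(** The instance of [monM2] with premise [\top], whose existential quantification is again
    [\top]. *)
Lemma mforallK x : mforall (mforall x) = mforall x.
Proof.
rewrite -[mforall x in LHS]himp1x monM2.
suff -> : mexists (\top : A) = \top by rewrite himp1x.
by apply/eqP; rewrite -le1x mexists_ge.
Qed.

Lemma le_mforall x y : x <= y -> mforall x <= mforall y.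
Proof.
move=> xy; rewrite -himp_eq1 -monM3 -[X in _ == X]mforall1; apply/eqP.
by congr mforall; apply/eqP; rewrite himp_eq1 (le_trans (mforall_le x)).
Qed.

Lemma base_mforall x : fixed_base (mforall x). Proof. exact: mforallK. Qed.

Lemma base_le c x : fixed_base c -> c <= x -> c <= mforall x.
Proof. by move=> Cc /le_mforall; rewrite Cc. Qed.

Lemma base1 : fixed_base \top. Proof. exact: mforall1. Qed.

Lemma base0 : fixed_base \bot.
Proof. by apply/eqP; rewrite -lex0 mforall_le. Qed.

Lemma base_himp c e : fixed_base c -> fixed_base e -> fixed_base (himp c e).
Proof.
by move=> Cc Ce; rewrite /fixed_base /= -{1}[c]Cc monM3 Cc Ce.
Qed.

(** By residuation [c] has to be below [himp e (mforall _)], and [monM3] moves the quantifier in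
    front of this implication because [e] is fixed. *)
Lemma base_meet c e : fixed_base c -> fixed_base e -> fixed_base (c `&` e).
Proof.
move=> Cc Ce; apply/le_anti; rewrite mforall_le /= himpP -{1}[c]Cc -[e in himp e]Ce.
by rewrite -monM3; apply: le_mforall; rewrite Ce -himpP.
Qed.

Lemma mexists_base c : fixed_base c -> mexists c = c.
Proof.
move=> Cc; apply/le_anti; rewrite mexists_ge andbT -himp_eq1.
rewrite -[X in himp _ X]Cc -monM2 Cc -[X in _ == X]mforall1.
by apply/eqP; congr mforall; apply/eqP; rewrite himp_eq1.
Qed.

Lemma base_dmneg c : fixed_base c -> fixed_base (dmneg c).
Proof. by move=> Cc; rewrite /fixed_base /= monQ dmnegK mexists_base. Qed.

Lemma base_mexists x : fixed_base (mexists x).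
Proof. by rewrite mexistsE; apply/base_dmneg/base_mforall. Qed.

Lemma base_delta c : fixed_base c -> fixed_base (delta c).
Proof. by move=> Cc; apply: base_himp base0; apply: base_dmneg. Qed.

(** For [c] the existential quantification of the meet of [x] and [dmneg x], the element [dmneg c]
    is the universal quantification of their join, so (C) reads [c <= dmneg c]. *)
Lemma base_middle x : exists2 c, fixed_base c & c <= dmneg c /\ x `&` dmneg x <= c.
Proof.
exists (mexists (x `&` dmneg x)); first exact: base_mexists.
split; last exact: mexists_ge.
rewrite mexistsE dmnegK -mexistsE dmnegI dmnegK joinC; exact: monC.
Qed.

End MonadicTheory.

(** * A total order on an arbitrary type, for indexing the points *)

Lemma exists_strict_total_order (T : Type) : exists lt : T -> T -> Prop,
  [/\ forall x, ~ lt x x, forall y x z, lt x y -> lt y z -> lt x z &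
      forall x y, [\/ lt x y, x = y | lt y x]].
Proof.
(* Unique minima of sets of at most three elements yield totality, antisymmetry and transitivity. *)
have [R woR] := @well_ordering_principle {classic T}.
have minR (x y z : {classic T}) : exists2 m,
    [\/ m = x, m = y | m = z] & [/\ R m x, R m y & R m z].
  have [|m [[+ min_m] _]] := woR (mem [:: x; y; z]).
    by exists x; rewrite inE eqxx.
  rewrite !inE => m_in; exists m.
    by case/or3P: m_in => /eqP; [apply: Or31 | apply: Or32 | apply: Or33].
  by split; apply: min_m; rewrite !inE eqxx ?orbT.
have totR (x y : {classic T}) : R x y \/ R y x.
  have [m m_in [mx my _]] := minR x y y.
  by case: m_in => e; rewrite e in mx my; [left | right | right].
have antiR (x y : {classic T}) : R x y -> R y x -> x = y.
  move=> xy yx; have [|m [_ unique_m]] := woR (mem [:: x; y]).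
    by exists x; rewrite inE eqxx.
  have Rxx (z : {classic T}) : R z z by case: (totR z z).
  have min_x : minimum_of R (mem [:: x; y]) x.
    by split=> [|z]; rewrite !inE ?eqxx // => /orP[] /eqP ->.
  have min_y : minimum_of R (mem [:: x; y]) y.
    by split=> [|z]; rewrite !inE ?eqxx ?orbT // => /orP[] /eqP ->.
  by rewrite -(unique_m x min_x); apply: unique_m.
exists (fun x y : {classic T} => R x y /\ x <> y); split.
- by move=> x [_].
- move=> y x z [xy nxy] [yz nyz]; split; last first.
    by move=> xz; apply: nxy; apply: antiR; rewrite // xz.
  have [m m_in [mx my mz]] := minR x y z.
  case: m_in => e; rewrite e in mx my mz => //.
    by case: nxy; apply: antiR.
  by case: nyz; apply: antiR.
- move=> x y; have [|nxy] := pselect (x = y); first exact: Or32.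
  by have [xy|yx] := totR x y; [apply: Or31 | apply: Or33; split=> // /esym].
Qed.

(** * The structure attached to an ultrafilter of a CMG-algebra *)

Section Representation.
Context {d : Order.disp_t} {A : cmgSimType d} {F0 : set A}.
Hypothesis ultraF0 : delta_ultrafilter F0.

Record point := Point {
  point_set : set A;
  pointP : delta_ultrafilter point_set /\
    forall c, fixed_base c -> F0 c -> point_set c
}.

Lemma point_ultra (v : point) : delta_ultrafilter (point_set v).
Proof. by case: (pointP v). Qed.

(** If [F0] omits [c], it contains the base element [hneg (delta c)], which [v] then contains
    too. *)
Lemma point_base (v : point) c : fixed_base c -> point_set v c <-> F0 c.
Proof.
have [ultra_v F0v] := pointP v => Cc; split=> [vc|]; last exact: F0v.
apply: contrapT => /(dultraNP ultraF0) F0c; apply: (dultraNP ultra_v c).2 vc.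
by apply: F0v F0c; apply: base_himp base0; apply: base_delta.
Qed.

Variable ltp : point -> point -> Prop.
Hypotheses (ltp_irr : forall v, ~ ltp v v)
  (ltp_trans : forall v u t, ltp u v -> ltp v t -> ltp u t)
  (ltp_total : forall u v, [\/ ltp u v, u = v | ltp v u]).

(** The integer dominates the lexicographic order, so every point has copies below and above any
    given index. *)
Definition index : Type := int * point.

Definition lt_index (i j : index) : Prop := i.1 < j.1 \/ i.1 = j.1 /\ ltp i.2 j.2.

Lemma lt_index_irr i : ~ lt_index i i.
Proof. by case=> [|[_]]; [rewrite ltxx | apply: ltp_irr]. Qed.

Lemma lt_index_trans j i k : lt_index i j -> lt_index j k -> lt_index i k.
Proof.
move=> [ij|[ij lij]] [jk|[jk ljk]].
- by left; apply: lt_trans jk.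
- by left; rewrite -jk.
- by left; rewrite ij.
- by right; rewrite ij; split=> //; apply: ltp_trans ljk.
Qed.

Lemma lt_index_total i j : [\/ lt_index i j, i = j | lt_index j i].
Proof.
case: i j => [m u] [n v]; have [mn|nm|->] := ltgtP m n.
- by apply: Or31; left.
- by apply: Or33; left.
- have [uv|->|vu] := ltp_total u v; [apply: Or31 | exact: Or32 | apply: Or33].
    by right.
  by right.
Qed.

Lemma lt_indexP i j : lt_index i j -> i.1 <= j.1.
Proof. by case=> [/ltW|[-> _]]. Qed.

Definition index_ultra (i : index) : delta_ultrafilter (point_set i.2) :=
  point_ultra i.2.

Lemma index_agree c e (i j : index) : fixed_base c -> fixed_base e ->
  point_set i.2 (himp c e) -> point_set j.2 (himp c e).
Proof. by move=> Cc Ce; rewrite !point_base //; apply: base_himp. Qed.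

(* If the infimum [mforall x] is not attained, compactness yields a point at
   which [x] lies in the cut of the base just above [mforall x]. *)
Lemma point_just_above x : ~ F0 (mforall x) -> exists v : point,
  forall e, fixed_base e -> point_set v (himp e x) -> F0 (himp e (mforall x)).
Proof.
move=> nF0x.
pose above e := fixed_base e /\ ~ F0 (himp e (mforall x)).
(* A point containing [G] puts no base element [e] below [x] unless [e] is already below [mforall x]
   modulo [F0]. *)
pose G := [set y | exists u e, [/\ fixed_base u, F0 u, above e &
  u `&` hneg (delta (himp e x)) <= y]].
have above1 : above \top by split; [exact: base1 | rewrite himp1x].
(* The family is directed because an implication from a meet is a join of implications and
   ultrafilters are prime on [delta] elements. *)
have aboveI e e' : above e -> above e' -> above (e `&` e').
  move=> [Ce ne] [Ce' ne']; split; first exact: base_meet.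
  rewrite himpIl => /(dfilter_delta ultraF0); rewrite deltaU.
  by case/(dultraU ultraF0).
have filG : delta_filter G.
  split.
  - by exists \top, \top; split=> //; [exact: base1 | exact: dfilter1 ultraF0].
  - move=> y y' [u [e [Cu F0u ae uy]]] [u' [e' [Cu' F0u' ae' uy']]].
    exists (u `&` u'), (e `&` e'); split; [exact: base_meet | | exact: aboveI |].
      exact: (dfilterI ultraF0).
    rewrite himpIl deltaU hnegU meetACA.
    exact: leI2.
  - move=> y y' yy' [u [e [Cu F0u ae uy]]]; exists u, e; split=> //.
    exact: le_trans yy'.
  - move=> y [u [e [Cu F0u ae uy]]]; exists (delta u), e; split=> //.
    + exact: base_delta.
    + exact: dfilter_delta ultraF0 _ F0u.
    + by rewrite -delta_hneg -deltaI le_delta.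
have G0 : ~ G \bot.
  (* Otherwise the base element formed by the meet of [u] and [e] is below [x], hence below
     [mforall x], and [F0] would contain [himp e (mforall x)]. *)
  move=> [u [e [Cu F0u [Ce nF0e]]]]; rewrite hnegP /delta hneg3 => ue.
  apply/nF0e/(dfilterS ultraF0 _ F0u).
  rewrite -himpP; apply: base_le; first exact: base_meet.
  by rewrite himpP; apply: le_trans ue (delta_le _).
have [F ultraF GF] := delta_ultrafilterP filG G0.
have F0F c : fixed_base c -> F0 c -> F c.
  by move=> Cc F0c; apply: GF; exists c, \top; split=> //; apply: leIl.
exists (Point (conj ultraF F0F)) => e Ce /= Fex; apply: contrapT => nF0e.
apply: (dultraNP ultraF (himp e x)).2 Fex; apply: GF.
exists \top, e; split=> //; [exact: base1 | exact: dfilter1 ultraF0 | exact: leIr].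
Qed.

Definition point0 : point := Point (conj ultraF0 (fun c _ F0c => F0c)).

Definition index0 : index := (0%R, point0).

Definition degrees := amalgam index0 index_ultra base0 base1 base_dmneg
  index_agree base_middle lt_index_irr lt_index_trans lt_index_total.

HB.instance Definition _ := GSim.on degrees.

Definition value (i : index) (a : A) : degrees := amalgam_inj index0 index_ultra
  base0 base1 base_dmneg index_agree base_middle lt_index_irr lt_index_trans
  lt_index_total i a.

Lemma value_le i a b : value i a <= value i b <-> point_set i.2 (himp a b).
Proof. exact: amalgam_inj_idx. Qed.

Lemma value_mono i a b : a <= b -> value i a <= value i b.
Proof. by move=> ab; apply/value_le/le_dle => //; apply: point_ultra. Qed.

Lemma value_base i j c : fixed_base c -> value i c = value j c.
Proof. exact: amalgam_inj_base. Qed.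

Lemma degrees_total : total (<=%O : rel degrees).
Proof. exact: amalgam_total. Qed.

Lemma value0 i : value i \bot = \bot. Proof. exact: amalgam_inj0. Qed.

Lemma value1 i : value i \top = \top. Proof. exact: amalgam_inj1. Qed.

Lemma value_dmneg i a : value i (dmneg a) = dmneg (value i a).
Proof. exact: amalgam_inj_dmneg. Qed.

Lemma value_meet i a b : value i (a `&` b) = value i a `&` value i b.
Proof. exact: (localization_meet (index_ultra i) (value_le i)). Qed.

Lemma value_join i a b : value i (a `|` b) = value i a `|` value i b.
Proof. exact: (localization_join (index_ultra i) (value_le i)). Qed.

Lemma value_himp i a b : value i (himp a b) = himp (value i a) (value i b).
Proof.
exact: (localization_himp (index_ultra i) degrees_total (value_le i) (value1 i)).
Qed.

(** A lower bound [b] not below [mforall x] must share its cut with [x] at a point just above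
    [mforall x]; a suitable copy of that point then gives [x] a value that is not above [b]. *)
Lemma value_inf i x :
  infimums (range (fun j => value j x)) (value i (mforall x)).
Proof.
split=> [_ [j _ <-]|q q_lb].
  by rewrite (value_base i j (base_mforall x)) value_mono ?mforall_le.
have [[j v] [b qE]] := amalgam_surj q; rewrite {q}qE -/(value _ _) in q_lb *.
rewrite (value_base i (j, v) (base_mforall x)); apply/value_le => /=.
apply: contrapT => nbx.
have ultra_v := point_ultra v.
have xb : point_set v (himp (mforall x) b).
  by case: (dle_total ultra_v b (mforall x)).
have [|u u_above] := @point_just_above x.
  move=> F0x; apply: nbx; apply: (dfilterS ultra_v (le_himpr _ _)).
  by apply/point_base => //; apply: base_mforall.
have base_le_u e : fixed_base e ->
    point_set u (himp e x) -> point_set v (himp e (mforall x)).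
  move=> Ce ux; apply/point_base; last exact: u_above.
  by apply: base_himp => //; apply: base_mforall.
have below_b e : fixed_base e ->
    point_set v (himp e (mforall x)) -> ~ point_set v (himp b e).
  by move=> Ce ex be; apply: nbx; exact: (dle_trans ultra_v be ex).
have j_pred : (j - 1 < j)%R by rewrite gtrDl.
have j_succ : (j < j + 1)%R by rewrite ltrDl.
(* One step against the stacking order: larger indices lie higher in the upper half and lower in the
   other half, so the copy at [k] falls below [b]. *)
pose k :=
  (if `[< upper_half (fun i : index => point_set i.2) fixed_base ((j, v), b) >]
  then j - 1 else j + 1)%R.
have : value (j, v) b <= value (k, u) x by apply: q_lb; exists (k, u).
(* The cuts are shown to coincide, and then each clause of [tie_le] is refuted. *)
move=> /amalgam_inj_le[cut_bx]; case.
  split=> e [Ce /= h]; split=> //=.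
    exact: (dle_trans ultra_v (base_le_u e Ce h) xb).
  have [ux|//] := dle_total (point_ultra u) e x.
  by case: (below_b e Ce (base_le_u e Ce ux)).
- move=> [c cb [Cc bc]]; have [_ /= cx] := cut_bx.1 _ cb.
  exact: (below_b c Cc (base_le_u c Cc cx) bc).
- have kj : k <> j.
    by rewrite /k; case: asboolP => _ jE; [have := j_pred | have := j_succ];
      rewrite jE ltxx.
  by move=> [/(congr1 fst) /= /esym].
- by move=> [upper /lt_indexP]; rewrite /k /= asboolT // leNgt j_pred.
- by move=> [nupper /lt_indexP]; rewrite /k /= asboolF // leNgt j_succ.
Qed.

(** Dual to [value_inf], since [dmneg] exchanges the quantifiers and reverses the chain. *)
Lemma value_sup i x :
  supremums (range (fun j => value j x)) (value i (mexists x)).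
Proof.
have [inf_lb inf_glb] := value_inf i (dmneg x).
rewrite mexistsE value_dmneg; split=> [_ [j _ <-]|q q_ub].
  by rewrite le_dmnegr -value_dmneg; apply: inf_lb; exists j.
rewrite le_dmnegl; apply: inf_glb => _ [j _ <-].
by rewrite value_dmneg le_dmneg //; apply: q_ub; exists j.
Qed.

Context {V : Type} (h : formula V -> A).
Hypothesis hom_h : formula_morphism h.

Definition value_structure : S5structure V := {|
  world := index;
  world_inhabited := inhabits index0;
  degree_disp := gquot_display;
  degree := degrees;
  degree_total := degrees_total;
  assignment := fun i p => value i (h (Var p))
|}.

Lemma truth_value a : @truth V value_structure a = fun i => value i (h a).
Proof.
elim: a => [p||| a IHa b IHb | a IHa b IHb | a IHa b IHb | a IHa | a IHa | a IHa];
  apply/funext => i //=.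
- by rewrite (hom_bot hom_h) value0.
- by rewrite (hom_top hom_h) value1.
- by rewrite IHa IHb (hom_and hom_h) value_meet.
- by rewrite IHa IHb (hom_or hom_h) value_join.
- by rewrite IHa IHb (hom_imp hom_h) value_himp.
- by rewrite IHa (hom_sim hom_h) value_dmneg.
- rewrite IHa (hom_box hom_h) /infimum ifF; last first.
    by apply/eqP => /seteqP[+ _] => /(_ (value i (h a))); apply; exists i.
  (* The default is excluded, so [infimum] selects some infimum, and infima are unique. *)
  apply: is_subset1_infimums (value_inf i (h a)).
  by apply: xgetPex; exists (value i (mforall (h a))); apply: value_inf.
- rewrite IHa (hom_dia hom_h) /supremum ifF; last first.
    by apply/eqP => /seteqP[+ _] => /(_ (value i (h a))); apply; exists i.
  apply: is_subset1_supremums (value_sup i (h a)).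
  by apply: xgetPex; exists (value i (mexists (h a))); apply: value_sup.
Qed.

Lemma safe_value_structure : safe value_structure.
Proof.
move=> a; rewrite truth_value; split.
  by exists (value index0 (mforall (h a))); apply: value_inf.
by exists (value index0 (mexists (h a))); apply: value_sup.
Qed.

End Representation.

(** * Refutation of algebraic counterexamples in structures, and the equivalence *)

Lemma CMGentails_of_S5 V (Gamma : set (formula V)) a :
  S5entails Gamma a -> CMGentails Gamma a.
Proof.
move=> ent d A h hom_h Gamma1; apply/eqP; rewrite -hneg_delta_eq0.
apply: contrapT => /negP Nha0.
(* Since [hneg (delta (h a))] is fixed by [delta], its up-set is a [delta_filter]; an ultrafilter
   extending it omits [h a]. *)
pose G := [set x : A | hneg (delta (h a)) <= x].
have filG : delta_filter G.
  split=> [|x y Gx Gy|x y xy Gx|x Gx]; rewrite /G /=.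
  - exact: lex1.
  - by rewrite lexI; apply/andP.
  - exact: le_trans xy.
  - by rewrite -delta_hneg le_delta.
have G0 : ~ G \bot by rewrite /G /= lex0; apply/negP.
have [F ultraF GF] := delta_ultrafilterP filG G0.
have [lt [lt_irr lt_tr lt_tot]] := exists_strict_total_order (@point d A F).
pose K := value_structure ultraF lt_irr lt_tr lt_tot h.
have modelK : S5model Gamma K.
  split=> [|g Gg i]; first exact: safe_value_structure.
  by rewrite truth_value // Gamma1 // value1.
(* The point of [index0] is [F] itself, so the degree of [a] there is [\top] only if [F] contains
   [h a]. *)
have := ent K modelK (index0 ultraF); rewrite truth_value //.
rewrite -(value1 ultraF lt_irr lt_tr lt_tot (index0 ultraF)) => a1.
have : value ultraF lt_irr lt_tr lt_tot (index0 ultraF) \top <=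
    value ultraF lt_irr lt_tr lt_tot (index0 ultraF) (h a) by rewrite a1.
move=> /value_le /=; rewrite himp1x.
apply/(dultraNP ultraF)/GF; exact: lexx.
Qed.

Theorem theorem6p5 (V : Type) (Gamma : set (formula V)) (phi : formula V) :
  (S5derives Gamma phi <-> S5entails Gamma phi) /\
  (S5entails Gamma phi <-> CMGentails Gamma phi).
Proof.
have CMG_S5 := @CMGentails_of_S5 V Gamma phi.
have S5_der := @S5_sound V Gamma phi.
have der_CMG := @CMG_complete V Gamma phi.
(* The three implications form a cycle. *)
by split; split; auto.
Qed.
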